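(* Let $(V,C,u)$ and $(W,K,e)$ be complete order unit spaces such that $V$ is spanned by the atoms of $C$ and $C=C_{sc}$. Let $\Psi\colon C^\circ\to K^\circ$ be a gauge-reversing map, and let $B$ be the symmetric bilinear form on $V$ determined by $B(p,y)=\psi_p(y)$ for all atoms $p$ of $C$ and all $y\in V$, where $\psi_p$ is the unique pure state of $(V,C,u)$ with $\psi_p(p)=1$. Then $C$ is self-dual with respect to $B$, i.e. $C=\{x\in V\colon B(x,y)\ge0\text{ for all }y\in C\}$.
   Context: An order unit space $(V,C,u)$ consists of a real vector space $V$, a cone $C\subseteq V$ (convex, $\lambda C\subseteq C$ for $\lambda\ge 0$, $C\cap -C=\{0\}$) with ordering $v\le w$ iff $w-v\in C$, such that $C$ is Archimedean (if $v\in V$, $w\in C$ and $nv\le w$ for all $n\in\mathbb{N}$, then $v\le 0$), and an order unit $u\in C$ (for each $v\in V$ there is $\lambda\ge0$ with $-\lambda u\le v\le\lambda u$). $V$ carries the order unit norm $\|v\|_u=\inf\{\lambda\ge0\colon -\lambda u\le v\le\lambda u\}$; complete means complete for this norm, and $C^\circ$ is the interior of $C$. For $v\in V$, $w\in C^\circ$ put $M(v/w)=\inf\{\mu\in\mathbb{R}\colon v\le\mu w\}$. A bijection $\Psi\colon C^\circ\to K^\circ$ is gauge-reversing if $M(v/w)=M(\Psi(w)/\Psi(v))$ for all $v,w\in C^\circ$. An extreme vector of $C$ is a nonzero $r\in C$ such that $0\le v\le r$ implies $v=\lambda r$ for some $\lambda\ge0$. An atom of $C$ is an extreme vector $p$ with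 $M(p/u)=1$. A state is a positive linear functional $\varphi$ on $V$ with $\varphi(u)=1$; $S$ is the set of states with the $w^*$-topology; pure states are the extreme points of $S$. For complete $(V,C,u)$, $V$ is identified with the space of $w^*$-continuous affine functions on $S$ via $x\mapsto(\varphi\mapsto\varphi(x))$, and $C$ with the nonnegative ones. $C_{sc}$ is the set of nonnegative functions on $S$ of the form $g_1-g_2$ with $g_1,g_2$ nonnegative bounded affine $w^*$-upper semi-continuous functions on $S$. Definition of $B$: under the stated hypotheses, for every atom $p$ of $C$ there is exactly one pure state $\psi_p$ of $(V,C,u)$ with $\psi_p(p)=1$, and $\psi_p(q)=\psi_q(p)$ for all atoms $p,q$. For $x=\sum_{k=1}^n\lambda_kp_k$ with $p_k$ atoms, $\lambda_k\in\mathbb{R}$, and $y\in V$, $B(x,y):=\sum_{k=1}^n\lambda_k\psi_{p_k}(y)$; this is a well-defined symmetric bilinear form on $V$. *)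

(* Defs.v *)
From HB Require Import structures.
From mathcomp Require Import all_boot all_order all_algebra.
From mathcomp Require Import all_classical all_reals all_analysis.

Set Implicit Arguments.
Unset Strict Implicit.
Unset Printing Implicit Defensive.

Import Order.TTheory GRing.Theory Num.Theory.
Import numFieldNormedType.Exports.

Local Open Scope classical_set_scope.
Local Open Scope ring_scope.

Definition cone_le (R : realType) (V : lmodType R) (C : set V) (v w : V) :=
  C (w - v).

Definition order_unit_norm (R : realType) (V : lmodType R) (C : set V) (u v : V)
    : R :=
  inf [set l : R | [/\ 0 <= l, cone_le C (- (l *: u)) v & cone_le C v (l *: u)]].

(* The norm of V is required to be the order unit norm, so the library topology
   of V is that of the order unit norm: C° below is the interior of C for this
   norm, and (V, C, u) is complete exactly when V is a completeNormedModType. *)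
Record order_unit_space (R : realType) (V : normedModType R) (C : set V) (u : V)
    : Prop := OrderUnitSpace {
  cone_convex : forall (t : R) (x y : V), 0 <= t <= 1 -> C x -> C y ->
    C (t *: x + (1 - t) *: y);
  cone_scale : forall (l : R) (x : V), 0 <= l -> C x -> C (l *: x);
  cone_pointed : forall x : V, (C x /\ C (- x)) <-> x = 0;
  cone_archimedean : forall v w : V, C w ->
    (forall n : nat, cone_le C (n%:R *: v) w) -> cone_le C v 0;
  order_unit_in : C u;
  order_unitP : forall v : V, exists l : R,
    [/\ 0 <= l, cone_le C (- (l *: u)) v & cone_le C v (l *: u)];
  normE_order_unit : forall v : V, `|v| = order_unit_norm C u v
}.

(* M(v/w) *)
Definition gauge (R : realType) (V : lmodType R) (C : set V) (v w : V) : R :=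
  inf [set mu : R | cone_le C v (mu *: w)].

(* Psi is total on V; only its restriction to the interior of C matters. *)
Definition gauge_reversing (R : realType) (V W : normedModType R)
    (C : set V) (K : set W) (Psi : V -> W) : Prop :=
  set_bij (C°) (K°) Psi /\
  forall v w : V, C° v -> C° w -> gauge C v w = gauge K (Psi w) (Psi v).

Section cone_with_unit.
Context {R : realType} {V : lmodType R}.
Variables (C : set V) (u : V).

Definition extreme_vector (r : V) : Prop :=
  [/\ r != 0, C r & forall v : V, cone_le C 0 v -> cone_le C v r ->
    exists2 l : R, 0 <= l & v = l *: r].

Definition atom (p : V) : Prop := extreme_vector p /\ gauge C p u = 1.

Definition spanned_by_atoms : Prop :=
  forall x : V, exists n (l : 'I_n -> R) (p : 'I_n -> V),
    (forall k, atom (p k)) /\ x = \sum_(k < n) l k *: p k.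

Definition states : set (V -> R) :=
  [set phi | [/\ scalar phi, forall v : V, C v -> 0 <= phi v & phi u = 1]].

Definition conv_comb (t : R) (phi psi : V -> R) : V -> R :=
  fun v => t * phi v + (1 - t) * psi v.

Definition pure_state (phi : V -> R) : Prop :=
  states phi /\
  forall (t : R) (phi1 phi2 : V -> R), 0 < t < 1 -> states phi1 -> states phi2 ->
    phi = conv_comb t phi1 phi2 -> phi1 = phi /\ phi2 = phi.

(* Functions on the state space are represented by functions on V -> R, of which
   only the values on the states are considered. *)
Definition affine_on_states (g : (V -> R) -> R) : Prop :=
  forall (t : R) (phi psi : V -> R), 0 <= t <= 1 -> states phi -> states psi ->
    g (conv_comb t phi psi) = t * g phi + (1 - t) * g psi.

(* The w*-topology of the state space is that of pointwise convergence. *)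
Definition usc_on_states (g : (V -> R) -> R) : Prop :=
  forall (phi : V -> R) (a : R), states phi -> g phi < a ->
    \forall psi \near within states (nbhs (phi : {ptws V -> R})), g psi < a.

Definition nonneg_on_states (g : (V -> R) -> R) : Prop :=
  forall phi : V -> R, states phi -> 0 <= g phi.

Definition nonneg_bounded_affine_usc (g : (V -> R) -> R) : Prop :=
  [/\ nonneg_on_states g, [bounded (g phi : R^o) | phi in states],
      affine_on_states g & usc_on_states g].

Definition Csc : set ((V -> R) -> R) :=
  [set f | nonneg_on_states f /\
    exists g1 g2 : (V -> R) -> R,
      [/\ nonneg_bounded_affine_usc g1, nonneg_bounded_affine_usc g2 &
          forall phi : V -> R, states phi -> f phi = g1 phi - g2 phi]].

(* C viewed as a set of functions on the state space *)
Definition cone_functions : set ((V -> R) -> R) :=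
  [set f | exists2 x : V, C x & forall phi : V -> R, states phi -> f phi = phi x].

Definition psi_atom (p : V) : V -> R :=
  xget (fun=> 0) [set psi : V -> R | pure_state psi /\ psi p = 1].

(* The form B: the value \sum_k l_k psi_{p_k}(y) for a decomposition
   x = \sum_k l_k p_k of x into atoms.  Neither the uniqueness of psi_p nor the
   independence of the decomposition is built into the definitions, which rely
   on choice. *)
Definition atom_form (x y : V) : R :=
  xget 0 [set z : R | exists n (l : 'I_n -> R) (p : 'I_n -> V),
    [/\ forall k, atom (p k), x = \sum_(k < n) l k *: p k &
        z = \sum_(k < n) l k * psi_atom (p k) y]].

End cone_with_unit.

Definition self_dual (R : realType) (V : lmodType R) (C : set V)
    (B : V -> V -> R) : Prop :=
  C = [set x | forall y : V, C y -> 0 <= B x y].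

(* Main.v *)
Require Import Defs.
From HB Require Import structures.
From mathcomp Require Import all_boot all_order all_algebra.
From mathcomp Require Import all_classical all_reals all_analysis.
From mathcomp Require Import ring lra.

Set Implicit Arguments.
Unset Strict Implicit.
Unset Printing Implicit Defensive.

(** Write [M(v/w)] for the gauge and [int C] for the interior.  A gauge-reversing
    map [Psi] satisfies [v <= mu w] iff [Psi w <= mu Psi v], and everything is
    drawn from this equivalence.

    Gauges of extreme vectors are extreme functionals composed with [Psi].  Let [phi] be a positive
    functional on an extreme ray of the dual cone of [K].  The sets
    [phi < 1] in [int K] are directed upward, so the interior points [w] with
    [phi (Psi w) < 1] are directed downward.  The hypothesis [C = C_sc] makes
    decreasing nets in [C] converge, and the infimum [r] of these points satisfies
    [M(r/v) = phi (Psi v)] for all interior [v]: we say that [phi] represents [r]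
    ([exists_represented]).  Such an [r] is extreme.  Conversely below every
    nonzero vector of [C] there is a represented one
    ([exists_represented_below]), by the Krein-Milman theorem in a cap of the dual
    cone; hence every extreme vector is represented.  Two consequences are
    used: nonzero vectors of [C] dominate extreme vectors
    ([extreme_vector_below]), and the gauges [M(r/.)] of extreme vectors determine
    the order of [int C] ([extreme_gauge_order]).

    The form.  The order interval between [u] and [u + t q], for [q] an atom, is a
    chain; so is its image, which forces [Psi] to map the line [u + t q] into a
    line.  Since the functional that represents [q] takes the value [1 / (1 + t)] at
    [Psi (u + t q)], for every atom [p] and every state [xi] with [xi p = 1] one
    gets [M(p / (u + t q)) = 1 - t / (1 + t) * xi q]
    ([represents_state_line]).  Thus [xi q] depends on [p] and [q] only, and as
    this formula says when [a p + s q <= u], an inequality symmetric in the two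
    atoms, it is symmetric in [p] and [q] ([state_atom_sym]).  The form [B] is
    therefore well defined and symmetric.

    Self-duality.  If [B(x, .)] is nonnegative on [C] then [psi_p x >= 0] for every
    atom [p], so that [v = u - t x] satisfies [M(p/v) >= 1 / psi_p v >= 1 = M(p/u)],
    whence [v <= u] and [x >= 0] ([atom_form_ge0_in]).  Conversely [B(., y)] is
    nonnegative on extreme vectors when [y] is in [C]; removing extreme vectors
    from [x] in [C] as long as possible, by Zorn's lemma and the convergence of
    decreasing nets, exhausts [x] without increasing [B(., y)]
    ([atom_form_ge0]).

    Linear functionals are produced by a single tool, [exists_extreme_minorant]:
    a sublinear function has an extreme linear minorant that touches it at a given
    point. *)

Import Order.TTheory GRing.Theory Num.Theory.
Import numFieldNormedType.Exports.
Local Open Scope classical_set_scope.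
Local Open Scope ring_scope.

(** * Linear identities in a module *)

(** Formal linear combinations.  The value of one is the sum of its coefficients
    times the variables, so that an identity between vectors follows from one ring
    identity per variable. *)
Inductive lin_expr (R : Type) : Type :=
  | LVar of nat
  | LZero
  | LAdd of lin_expr R & lin_expr R
  | LOpp of lin_expr R
  | LScale of R & lin_expr R.

Section lin_expr.
Context {R : pzRingType} {V : lmodType R}.

Fixpoint lin_eval (env : seq V) (x : lin_expr R) : V :=
  match x with
  | LVar i => nth 0 env i
  | LZero => 0
  | LAdd x1 x2 => lin_eval env x1 + lin_eval env x2
  | LOpp x1 => - lin_eval env x1
  | LScale a x1 => a *: lin_eval env x1
  end.

Fixpoint lin_coef (i : nat) (x : lin_expr R) : R :=
  match x with
  | LVar j => if eqn i j then 1 else 0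
  | LZero => 0
  | LAdd x1 x2 => lin_coef i x1 + lin_coef i x2
  | LOpp x1 => - lin_coef i x1
  | LScale a x1 => a * lin_coef i x1
  end.

Fixpoint lin_agree (n : nat) (x y : lin_expr R) : Prop :=
  match n with
  | 0 => True
  | m.+1 => lin_coef m x = lin_coef m y /\ lin_agree m x y
  end.

Lemma lin_evalE (env : seq V) (x : lin_expr R) :
  lin_eval env x = \sum_(i < size env) lin_coef i x *: nth 0 env i.
Proof.
elim: x => [j||x1 IH1 x2 IH2|x1 IH1|a x1 IH1] /=.
- have [jlt|jge] := ltnP j (size env).
    rewrite (bigD1 (Ordinal jlt)) //= eqnE eqxx scale1r big1 ?addr0 // => i ij.
    rewrite (_ : (i == j :> nat) = false) ?scale0r //.
    by apply: contraNF ij => /eqP ij; apply/eqP/val_inj.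
  rewrite nth_default // big1 // => i _.
  rewrite eqnE; case: eqVneq => [eij|_]; last by rewrite scale0r.
  by move: (ltn_ord i); rewrite eij ltnNge jge.
- by rewrite big1 // => i _; rewrite scale0r.
- by rewrite IH1 IH2 -big_split; apply: eq_bigr => i _; rewrite scalerDl.
- by rewrite IH1 -sumrN; apply: eq_bigr => i _; rewrite scaleNr.
- by rewrite IH1 scaler_sumr; apply: eq_bigr => i _; rewrite scalerA.
Qed.

Lemma lin_eval_eq (env : seq V) (x y : lin_expr R) :
  lin_agree (size env) x y -> lin_eval env x = lin_eval env y.
Proof.
move=> xy; rewrite !lin_evalE; apply: eq_bigr => i _; congr (_ *: _).
move: (size env) xy i => n; elim: n => [_ []//|n IHn] [xyn xy'] i.
have [->//|neq] := eqVneq (i : nat) n.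
have ilt : (i < n)%N by rewrite ltn_neqAle neq -ltnS ltn_ord.
exact: (IHn xy' (Ordinal ilt)).
Qed.

End lin_expr.

Ltac lin_mem v env :=
  lazymatch env with
  | nil => constr:(false)
  | cons v _ => constr:(true)
  | cons _ ?t => lin_mem v t
  end.

Ltac lin_index v env :=
  lazymatch env with
  | cons v _ => constr:(0%N)
  | cons _ ?t => let n := lin_index v t in constr:(S n)
  end.

Ltac lin_atoms x env :=
  lazymatch x with
  | (?a + ?b)%R => let env1 := lin_atoms a env in lin_atoms b env1
  | (- ?a)%R => lin_atoms a env
  | (_ *: ?a)%R => lin_atoms a env
  | (0)%R => env
  | _ => lazymatch lin_mem x env with
         | true => env
         | false => constr:(cons x env)
         end
  end.

Ltac lin_reify R x env :=
  lazymatch x with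
  | (?a + ?b)%R =>
      let a' := lin_reify R a env in let b' := lin_reify R b env in
      constr:(@LAdd R a' b')
  | (- ?a)%R => let a' := lin_reify R a env in constr:(@LOpp R a')
  | (?l *: ?a)%R => let a' := lin_reify R a env in constr:(@LScale R l a')
  | (0)%R => constr:(@LZero R)
  | _ => let n := lin_index x env in constr:(@LVar R n)
  end.

Ltac module_eq0 R :=
  lazymatch goal with
  | |- ?x = ?y :> ?T =>
      let env1 := lin_atoms x constr:(@nil T) in
      let env := lin_atoms y env1 in
      let x' := lin_reify R x env in
      let y' := lin_reify R y env in
      apply: (@lin_eval_eq _ _ env x' y');
      cbv [lin_agree lin_coef size eqn]
  end.

(** Reduces an equality between linear combinations of vectors with coefficients in
    [R] to equalities between coefficients, and leaves those that [ring] does not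
    prove, such as the ones with inverses. *)
Ltac module_eq R :=
  module_eq0 R; repeat (split; [try ring | idtac]); try exact: I.

(** * Extreme linear minorants of sublinear functions *)

Section sublinear.
Context {R : realType} {V : lmodType R}.
Implicit Types (P : V -> R) (phi : V -> R).

Definition sublinear P :=
  (forall a b, P (a + b) <= P a + P b) /\
  (forall l a, 0 < l -> P (l *: a) <= l * P a).

Definition minorant P phi := scalar phi /\ forall y, phi y <= P y.

Definition extreme_minorant P phi :=
  minorant P phi /\
  forall t phi1 phi2, 0 < t < 1 -> minorant P phi1 -> minorant P phi2 ->
    phi = conv_comb t phi1 phi2 -> phi1 = phi /\ phi2 = phi.

Lemma scalf0 phi : scalar phi -> phi 0 = 0.
Proof. by move=> lin; move: (lin 1 0 0); rewrite scaler0 addr0; lra. Qed.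

Lemma scalfD phi a b : scalar phi -> phi (a + b) = phi a + phi b.
Proof. by move=> lin; move: (lin 1 a b); rewrite scale1r mul1r. Qed.

Lemma scalfZ phi l a : scalar phi -> phi (l *: a) = l * phi a.
Proof. by move=> lin; move: (lin l a 0); rewrite addr0 scalf0 // addr0. Qed.

Lemma scalfN phi a : scalar phi -> phi (- a) = - phi a.
Proof. by move=> lin; rewrite -scaleN1r scalfZ // mulN1r. Qed.

Lemma scalfB phi a b : scalar phi -> phi (a - b) = phi a - phi b.
Proof. by move=> lin; rewrite scalfD // scalfN. Qed.

Lemma scalf_sum phi n (l : 'I_n -> R) (p : 'I_n -> V) : scalar phi ->
  phi (\sum_(k < n) l k *: p k) = \sum_(k < n) l k * phi (p k).
Proof.
move=> lin; elim: n l p => [|n IHn] l p; first by rewrite !big_ord0 scalf0.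
by rewrite !big_ord_recr /= scalfD // IHn scalfZ.
Qed.

Lemma sublinear0 P : sublinear P -> P 0 = 0.
Proof.
move=> [sub hom]; move: (sub 0 0) (hom 2^-1 0); rewrite addr0 scaler0.
by move=> h1 /(_ ltac:(lra)) h2; lra.
Qed.

Lemma sublinearZ P l a : sublinear P -> 0 <= l -> P (l *: a) = l * P a.
Proof.
move=> sP; rewrite le_eqVlt => /orP[/eqP <-|l0].
  by rewrite scale0r mul0r sublinear0.
apply/eqP; rewrite eq_le sP.2 //=.
have := sP.2 l^-1 (l *: a); rewrite invr_gt0 scalerA mulVf ?gt_eqF //.
by rewrite scale1r mulrC ler_pdivlMr // mulrC; apply.
Qed.

Lemma sublinearN P a : sublinear P -> - P (- a) <= P a.
Proof.
move=> sP; have := sP.1 a (- a); rewrite subrr sublinear0 //; lra.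
Qed.

(** The sublinear functions below are all infima.  They are given by a relation
    [E y mu], meaning that [mu] is one of the upper bounds of the value at [y];
    convexity of [E] is then what has to be checked. *)
Definition epi_inf (E : V -> R -> Prop) (y : V) : R := inf [set mu | E y mu].

Definition epigraph (E : V -> R -> Prop) :=
  [/\ forall y, exists mu, E y mu,
      forall y, exists m, forall mu, E y mu -> m <= mu,
      forall a b mu nu, E a mu -> E b nu -> exists2 k, k <= mu + nu & E (a + b) k &
      forall l a mu, 0 < l -> E a mu -> exists2 k, k <= l * mu & E (l *: a) k].

Lemma epi_inf_le E y mu : epigraph E -> E y mu -> epi_inf E y <= mu.
Proof.
move=> [_ bnd _ _] Ey; apply: ge_inf => //=.
by have [m hm] := bnd y; exists m => nu /hm.
Qed.

Lemma le_epi_inf E y m : epigraph E -> (forall mu, E y mu -> m <= mu) ->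
  m <= epi_inf E y.
Proof.
by move=> [ne _ _ _] h; apply: lb_le_inf => //; have [mu] := ne y; exists mu.
Qed.

Lemma epi_inf_lt E y m : epigraph E -> epi_inf E y < m -> exists2 mu, E y mu & mu < m.
Proof.
move=> epiE lt; apply: contrapT => h; move: lt; apply/negP; rewrite -leNgt.
apply: le_epi_inf => // mu Emu; rewrite leNgt; apply/negP => mulm.
by apply: h; exists mu.
Qed.

Lemma epi_inf_sublinear E : epigraph E -> sublinear (epi_inf E).
Proof.
move=> epiE; have [_ _ add sc] := epiE; split=> [a b|l a l0].
  apply/ler_addgt0Pl => e e0.
  have [|mu Emu ltmu] := @epi_inf_lt E a (epi_inf E a + e / 2) epiE.
    by rewrite ltrDl divr_gt0.
  have [|nu Enu ltnu] := @epi_inf_lt E b (epi_inf E b + e / 2) epiE.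
    by rewrite ltrDl divr_gt0.
  have [k kle Ek] := add _ _ _ _ Emu Enu.
  by have := epi_inf_le epiE Ek; lra.
rewrite mulrC -ler_pdivrMr //; apply: le_epi_inf => // mu Emu.
have [k kle Ek] := sc _ _ _ l0 Emu.
by rewrite ler_pdivrMr // mulrC; exact: le_trans (epi_inf_le epiE Ek) _.
Qed.

(** For [t > 0] and [s = 1 / t] the lower bound of [mu] is the difference quotient
    [(q (y1 + s y) - q y1) / s], so the infimum is the derivative of [q] at [y1] in
    the direction [y].  Its linear minorants are those of [q] that agree with [q]
    at [y1]. *)
Definition deriv_epi (q : V -> R) (y1 y : V) (mu : R) :=
  exists2 t, 0 <= t & q (y + t *: y1) - t * q y1 <= mu.

Lemma deriv_epigraph q y1 : sublinear q -> epigraph (deriv_epi q y1).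
Proof.
move=> sq; split.
- by move=> y; exists (q y); exists 0; rewrite // scale0r addr0 mul0r subr0.
- move=> y; exists (- q (- y)) => mu [t t0]; apply: le_trans.
  have := sq.1 (y + t *: y1) (- y).
  rewrite (_ : y + t *: y1 - y = t *: y1); last by module_eq R.
  by rewrite sublinearZ //; lra.
- move=> a b mu nu [s s0 hs] [t t0 ht]; exists (mu + nu) => //.
  exists (s + t); first exact: addr_ge0.
  have := sq.1 (a + s *: y1) (b + t *: y1).
  rewrite (_ : a + s *: y1 + (b + t *: y1) = a + b + (s + t) *: y1); last by module_eq R.
  by lra.
- move=> l a mu l0 [t t0 ht]; exists (l * mu) => //.
  exists (l * t); first by rewrite mulr_ge0 // ltW.
  rewrite -scalerA -scalerDr (sublinearZ _ sq (ltW l0)).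
  by have := ler_wpM2l (ltW l0) ht; lra.
Qed.

(** A face of the convex set of linear minorants of [P], encoded by its support
    function [q]. *)
Definition face P q :=
  [/\ sublinear q, forall y, q y <= P y &
      forall t phi1 phi2, 0 < t < 1 -> minorant P phi1 -> minorant P phi2 ->
        (forall y, conv_comb t phi1 phi2 y <= q y) ->
        (forall y, phi1 y <= q y) /\ (forall y, phi2 y <= q y)].

Lemma deriv_le q y1 y : sublinear q -> epi_inf (deriv_epi q y1) y <= q y.
Proof.
move=> sq; apply: epi_inf_le (deriv_epigraph y1 sq) _.
by exists 0; rewrite // scale0r addr0 mul0r subr0.
Qed.

Lemma derivN_le q y1 : sublinear q -> epi_inf (deriv_epi q y1) (- y1) <= - q y1.
Proof.
move=> sq; apply: epi_inf_le (deriv_epigraph y1 sq) _.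
by exists 1; rewrite // scale1r addNr sublinear0 // mul1r sub0r.
Qed.

(** A convex combination of two linear minorants of [q] that touches [q] at [y1]
    forces both of them to touch [q] there. *)
Lemma deriv_face P q y1 : face P q -> face P (epi_inf (deriv_epi q y1)).
Proof.
move=> [sq qP facq]; have epi := deriv_epigraph y1 sq; split.
- exact: epi_inf_sublinear.
- by move=> y; exact: le_trans (deriv_le _ _ sq) (qP y).
move=> t phi1 phi2 t01 m1 m2 comb.
have [phi1q phi2q] : (forall y, phi1 y <= q y) /\ (forall y, phi2 y <= q y).
  by apply: (facq t) => // y; exact: le_trans (comb y) (deriv_le _ _ sq).
have touch : phi1 y1 = q y1 /\ phi2 y1 = q y1.
  move: (comb (- y1)) (derivN_le y1 sq) (phi1q y1) (phi2q y1).
  rewrite /conv_comb (scalfN _ m1.1) (scalfN _ m2.1) => h1 h2 h3 h4.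
  have {h1 h2} : 0 <= t * (phi1 y1 - q y1) + (1 - t) * (phi2 y1 - q y1) by nra.
  case/andP: t01 => t0 t1 h.
  have a0 : t * (phi1 y1 - q y1) <= 0 by nra.
  have b0 : (1 - t) * (phi2 y1 - q y1) <= 0 by nra.
  split; apply/eqP; rewrite eq_le ?h3 ?h4 /= leNgt; apply/negP => lt; nra.
have main phi : scalar phi -> (forall y, phi y <= q y) -> phi y1 = q y1 ->
    forall y, phi y <= epi_inf (deriv_epi q y1) y.
  move=> lin le eq y; apply: le_epi_inf => // mu [s s0]; apply: le_trans.
  have := le (y + s *: y1); rewrite scalfD // scalfZ // eq; lra.
by split; apply: main; [exact: m1.1| |exact: touch.1|exact: m2.1| |exact: touch.2].
Qed.

(** A sublinear [q <= P] satisfies [q y >= - q (- y) >= - P (- y)], which bounds a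
    chain from below. *)
Lemma chain_epigraph P (A : set (V -> R)) : A !=set0 ->
  (forall q, A q -> sublinear q) -> (forall q, A q -> forall y, q y <= P y) ->
  total_on A (fun q1 q2 => forall y, q2 y <= q1 y) ->
  epigraph (fun y mu => exists2 q, A q & q y = mu).
Proof.
move=> [q0 Aq0] sA AP tot; split.
- by move=> y; exists (q0 y); exists q0.
- move=> y; exists (- P (- y)) => _ [q Aq <-].
  by apply: le_trans (sublinearN _ (sA _ Aq)); rewrite lerN2; exact: AP.
- move=> a b _ _ [q Aq <-] [q' Aq' <-].
  have [h|h] := tot _ _ Aq Aq'.
    exists (q' (a + b)); last by exists q'.
    by apply: le_trans ((sA _ Aq').1 _ _) _; rewrite lerD2r.
  exists (q (a + b)); last by exists q.
  by apply: le_trans ((sA _ Aq).1 _ _) _; rewrite lerD2l.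
- move=> l a _ l0 [q Aq <-]; exists (q (l *: a)); last by exists q.
  exact: (sA _ Aq).2.
Qed.

Lemma chain_face P (A : set (V -> R)) : A !=set0 ->
  (forall q, A q -> face P q) ->
  total_on A (fun q1 q2 => forall y, q2 y <= q1 y) ->
  face P (epi_inf (fun y mu => exists2 q, A q & q y = mu)).
Proof.
move=> Ane fA tot.
have epi : epigraph (fun y mu => exists2 q, A q & q y = mu).
  apply: (@chain_epigraph P) => // q Aq; first by have [] := fA _ Aq.
  by have [_ h _] := fA _ Aq.
split; first exact: epi_inf_sublinear.
  move=> y; have [q Aq] := Ane; have [_ qP _] := fA _ Aq.
  by apply: le_trans (qP y); apply: epi_inf_le => //; exists q.
move=> t phi1 phi2 t01 m1 m2 comb.
have h q : A q -> (forall y, phi1 y <= q y) /\ (forall y, phi2 y <= q y).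
  move=> Aq; have [_ _ fq] := fA _ Aq; apply: (fq t) => // y.
  by apply: le_trans (comb y) _; apply: epi_inf_le => //; exists q.
by split=> y; apply: le_epi_inf => // _ [q Aq <-]; [exact: (h q Aq).1|exact: (h q Aq).2].
Qed.

(** Hahn-Banach and Krein-Milman at once.  By Zorn's lemma there is a minimal
    face of [P] below the face where [P] is touched at [y0]; since it is equal
    to all its derivatives it is additive. *)
Lemma exists_extreme_minorant P y0 : sublinear P ->
  exists2 phi, extreme_minorant P phi & phi y0 = P y0.
Proof.
move=> sP.
have face0 : face P (epi_inf (deriv_epi P y0)).
  by apply: deriv_face; split => // t phi1 phi2 _ [_ ?] [_ ?] _.
set q0 := epi_inf _ in face0.
pose T := {q : V -> R | face P q /\ forall y, q y <= q0 y}.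
pose mkT q (fq : face P q) (qq0 : forall y, q y <= q0 y) : T :=
  exist (fun q => face P q /\ forall y, q y <= q0 y) q (conj fq qq0).
pose below (q1 q2 : T) := `[< forall y, sval q2 y <= sval q1 y >].
have [| | | |[q [fq qq0]] qmin] := @Zorn T below.
- by move=> q; apply/asboolP.
- move=> r s t /asboolP h1 /asboolP h2; apply/asboolP => y.
  exact: le_trans (h2 y) (h1 y).
- move=> [s hs] [t ht] /asboolP h1 /asboolP h2; apply: eq_exist => /=.
  by apply/funext => y; apply/eqP; rewrite eq_le h1 h2.
- move=> A tot; have [[a Aa]|Ane] := pselect (A !=set0); last first.
    exists (mkT _ face0 (fun=> lexx _)) => s As.
    by exfalso; apply: Ane; exists s.
  pose A' := [set sval q | q in A].
  have A'ne : A' !=set0 by exists (sval a); exists a.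
  have A'f q : A' q -> face P q by move=> [[r [? ?]] _ <-].
  have A'tot : total_on A' (fun q1 q2 => forall y, q2 y <= q1 y).
    move=> _ _ [q Aq <-] [r Ar <-].
    by have [/asboolP|/asboolP] := tot _ _ Aq Ar; [left|right].
  have fA := chain_face A'ne A'f A'tot.
  have epiA : epigraph (fun y mu => exists2 q, A' q & q y = mu).
    apply: (@chain_epigraph P) => // q /A'f; first by case.
    by case.
  have leA q y : A q -> epi_inf (fun y mu => exists2 q, A' q & q y = mu) y <= sval q y.
    by move=> Aq; apply: epi_inf_le => //; exists (sval q) => //; exists q.
  have lea y : epi_inf (fun y mu => exists2 q, A' q & q y = mu) y <= q0 y.
    exact: le_trans (leA a y Aa) ((svalP a).2 y).
  exists (mkT _ fA lea) => s As.
  by apply/asboolP => y /=; exact: leA.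
have [sq qP facq] := fq.
have derq y1 y : epi_inf (deriv_epi q y1) y = q y.
  have fd := deriv_face y1 fq.
  have led z : epi_inf (deriv_epi q y1) z <= q0 z.
    exact: le_trans (deriv_le _ _ sq) (qq0 z).
  have bel : below (mkT _ fq qq0) (mkT _ fd led).
    by apply/asboolP => z /=; exact: deriv_le.
  exact: (congr1 (fun s : T => sval s y) (qmin _ bel)).
have addq a b : q (a + b) = q a + q b.
  apply/eqP; rewrite eq_le sq.1 /= -(derq b a).
  suff : epi_inf (deriv_epi q b) a <= q (a + b) - q b by lra.
  apply: epi_inf_le; first exact: deriv_epigraph.
  by exists 1; rewrite // scale1r mul1r.
have oppq a : q (- a) = - q a.
  by have := addq a (- a); rewrite subrr sublinear0 //; lra.
have linq : scalar q.
  move=> l a b; rewrite addq; congr (_ + _).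
  have [l0|l0] := leP 0 l; first exact: sublinearZ.
  by rewrite -[l]opprK scaleNr oppq (sublinearZ _ sq) ?mulNr // oppr_ge0 ltW.
exists q.
  split=> // t phi1 phi2 t01 m1 m2 qE.
  have [|h1 h2] := facq t phi1 phi2 t01 m1 m2; first by rewrite -qE.
  have eqm phi : scalar phi -> (forall y, phi y <= q y) -> phi = q.
    move=> lin le; apply/funext => y; apply/eqP; rewrite eq_le le /=.
    by have := le (- y); rewrite scalfN // oppq lerN2.
  by split; apply: eqm => //; [exact: m1.1|exact: m2.1].
apply/eqP; rewrite eq_le qP /=.
have := qq0 (- y0); rewrite oppq => h.
by have := le_trans h (derivN_le _ sP); rewrite lerN2.
Qed.

End sublinear.

(** * Cones with an order unit *)

(** The content of an order unit space that does not involve the norm.  The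
    one-point space is excluded, because gauges are infima of sets that are not
    bounded below there. *)
Record unital_cone (R : realType) (V : lmodType R) (C : set V) (u : V) : Prop :=
  UnitalCone {
  ucD : forall x y : V, C x -> C y -> C (x + y);
  ucZ : forall (l : R) (x : V), 0 <= l -> C x -> C (l *: x);
  uc_anti : forall x : V, C x -> C (- x) -> x = 0;
  uc_closed : forall x : V, (forall e : R, 0 < e -> C (x + e *: u)) -> C x;
  uc_unit : C u;
  uc_bound : forall x : V, exists2 l : R, 0 <= l & C (x + l *: u);
  uc_neq0 : u != 0
}.

(** The interior for the order unit norm, in terms of the order. *)
Definition inner (R : realType) (V : lmodType R) (C : set V) (u x : V) : Prop :=
  exists2 d : R, 0 < d & C (x - d *: u).

Definition up_directed (R : realType) (V : lmodType R) (C A : set V) : Prop :=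
  forall x y, A x -> A y -> exists2 z, A z & C (z - x) /\ C (z - y).

Definition down_directed (R : realType) (V : lmodType R) (C A : set V) : Prop :=
  forall x y, A x -> A y -> exists2 z, A z & C (x - z) /\ C (y - z).

Definition positive_functional (R : realType) (V : lmodType R) (C : set V)
    (phi : V -> R) : Prop :=
  scalar phi /\ forall x, C x -> 0 <= phi x.

Definition extreme_functional (R : realType) (V : lmodType R) (C : set V)
    (phi : V -> R) : Prop :=
  [/\ positive_functional C phi, exists x, phi x != 0 &
      forall phi1, positive_functional C phi1 ->
        (forall x, C x -> phi1 x <= phi x) -> exists l, forall x, phi1 x = l * phi x].

(** The infimum of the gauges relative to the points of [K], truncated below at 0,
    which makes them decrease as the point increases.  Its linear minorants are
    the positive functionals bounded by 1 on [K]. *)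
Definition gauge_epi (R : realType) (V : lmodType R) (C K : set V) (y : V)
    (mu : R) : Prop :=
  0 <= mu /\ exists2 k, K k & C (mu *: k - y).

Section unital_cone.
Context {R : realType} {V : lmodType R} {C : set V} {u : V}.
Hypothesis hC : unital_cone C u.
Implicit Types (x y v w : V) (phi : V -> R).

Lemma uc_eq x y : C x -> x = y -> C y.
Proof. by move=> Cx <-. Qed.

Lemma uc0 : C 0.
Proof. by rewrite -(scale0r u); apply: (ucZ hC) => //; exact: uc_unit. Qed.

Lemma uc_trans x y z : C (y - x) -> C (z - y) -> C (z - x).
Proof. by move=> xy yz; apply: uc_eq (ucD hC xy yz) _; module_eq R. Qed.

Lemma uc_le_anti x y : C (y - x) -> C (x - y) -> x = y.
Proof.
move=> xy yx; apply/eqP; rewrite -subr_eq0; apply/eqP.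
by apply: (uc_anti hC) => //; rewrite opprB.
Qed.

Lemma uc_unitN (d : R) : C (- (d *: u)) -> d <= 0.
Proof.
move=> h; rewrite leNgt; apply/negP => d0.
suff u0 : u = 0 by move: (uc_neq0 hC); rewrite u0 eqxx.
apply: (uc_anti hC); first exact: (uc_unit hC).
have dV : 0 <= d^-1 by rewrite invr_ge0 ltW.
apply: uc_eq (ucZ hC dV h) _; module_eq R; field; lra.
Qed.

Lemma inner_unit : inner C u u.
Proof. by exists 1 => //; rewrite scale1r subrr; exact: uc0. Qed.

Lemma innerD v x : inner C u v -> C x -> inner C u (v + x).
Proof.
move=> [d d0 hd] Cx; exists d => //.
by apply: uc_eq (ucD hC hd Cx) _; module_eq R.
Qed.

Lemma inner_le v w : inner C u v -> C (w - v) -> inner C u w.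
Proof.
by move=> iv vw; rewrite (_ : w = v + (w - v)); [exact: innerD|module_eq R].
Qed.

Lemma inner_in v : inner C u v -> C v.
Proof.
move=> [d d0 hd]; apply: uc_eq (ucD hC hd (ucZ hC (ltW d0) (uc_unit hC))) _.
by module_eq R.
Qed.

Lemma innerZ (l : R) v : 0 < l -> inner C u v -> inner C u (l *: v).
Proof.
move=> l0 [d d0 hd]; exists (l * d); first exact: mulr_gt0.
by apply: uc_eq (ucZ hC (ltW l0) hd) _; module_eq R.
Qed.

Lemma innerDZ x (e : R) : C x -> 0 < e -> inner C u (x + e *: u).
Proof.
by move=> Cx e0; rewrite addrC; apply: innerD => //; apply: innerZ => //; exact: inner_unit.
Qed.

Lemma inner_bound w x : inner C u w -> exists2 l : R, 0 <= l & C (l *: w - x).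
Proof.
move=> [d d0 hd]; have [l l0 hl] := uc_bound hC (- x).
have dl : 0 <= l / d by apply: divr_ge0 => //; exact: ltW.
exists (l / d) => //.
apply: uc_eq (ucD hC hl (ucZ hC dl hd)) _; module_eq R; field; lra.
Qed.

Lemma inner_neq0 w : inner C u w -> w != 0.
Proof.
move=> [d d0 hd]; apply/eqP => w0; move: hd; rewrite w0 sub0r => /uc_unitN; lra.
Qed.

Lemma inner_gt0 w x (mu : R) : inner C u w -> C x -> x != 0 -> C (mu *: w - x) ->
  0 < mu.
Proof.
move=> iw Cx x0 h; rewrite ltNge; apply/negP => mu0.
have /(ucZ hC) : 0 <= - mu by rewrite oppr_ge0.
move=> /(_ _ (inner_in iw)) h'.
move/eqP: x0; apply; apply: (uc_anti hC) => //.
by apply: uc_eq (ucD hC h h') _; module_eq R.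
Qed.

Lemma closed_along d x : C d -> (forall e : R, 0 < e -> C (x + e *: d)) -> C x.
Proof.
move=> Cd h; apply: (uc_closed hC) => e e0.
have [l l0 hl] := inner_bound d inner_unit.
have k0 : 0 < e / (l + 1) by apply: divr_gt0 => //; lra.
have h1 := ucD hC (h _ k0) (ucZ hC (ltW k0) hl).
apply: uc_eq (ucD hC h1 (ucZ hC (ltW k0) (uc_unit hC))) _.
by module_eq R; field; lra.
Qed.

Lemma inner_closed_le v w (mu : R) : inner C u w ->
  (forall nu, mu < nu -> C (nu *: w - v)) -> C (mu *: w - v).
Proof.
move=> iw h; apply: (closed_along (inner_in iw)) => e e0.
by apply: uc_eq (h (mu + e) _) _; [rewrite ltrDl|module_eq R].
Qed.

Lemma inner_leZ v w (mu nu : R) : inner C u w -> mu <= nu -> C (mu *: w - v) ->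
  C (nu *: w - v).
Proof.
move=> iw munu h; have nm : 0 <= nu - mu by rewrite subr_ge0.
by apply: uc_eq (ucD hC h (ucZ hC nm (inner_in iw))) _; module_eq R.
Qed.

(** The infimum that defines the gauge is attained. *)
Lemma gauge_le v w (mu : R) : inner C u w ->
  (gauge C v w <= mu) <-> C (mu *: w - v).
Proof.
move=> iw; rewrite /gauge /cone_le.
have [l l0 hl] := inner_bound v iw.
have [l' l'0 hl'] := inner_bound (- v) iw.
have lb : has_lbound [set nu : R | C (nu *: w - v)].
  exists (- l') => nu /= hnu; rewrite leNgt; apply/negP => lt.
  have iw' : inner C u ((- l' - nu) *: w) by apply: innerZ => //; rewrite subr_gt0.
  move/eqP: (inner_neq0 iw'); apply; apply: (uc_anti hC); first exact: inner_in.
  by apply: uc_eq (ucD hC hnu hl') _; module_eq R.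
split=> h; last exact: ge_inf.
apply: inner_closed_le => // nu munu.
have [|k hk klt] := @inf_lt _ [set nu : R | C (nu *: w - v)] nu _ (le_lt_trans h munu).
  by exists l.
exact: inner_leZ (ltW klt) hk.
Qed.

Lemma functional_le phi x y : positive_functional C phi -> C (y - x) -> phi x <= phi y.
Proof. by move=> [lin pos] /pos; rewrite scalfB // subr_ge0. Qed.

Lemma functional_eq0 phi w : positive_functional C phi -> inner C u w ->
  phi w <= 0 -> forall x, phi x = 0.
Proof.
move=> pphi iw w0 x; have [lin pos] := pphi.
have bnd y : phi y <= 0.
  have [l l0 hl] := inner_bound y iw.
  by have := functional_le pphi hl; rewrite scalfZ //; nra.
by have := bnd x; have := bnd (- x); rewrite scalfN //; lra.
Qed.

Lemma extreme_functional_gt0 phi w : extreme_functional C phi -> inner C u w ->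
  0 < phi w.
Proof.
move=> [pphi [x x0] _] iw; rewrite ltNge; apply/negP => /(functional_eq0 pphi iw) h.
by rewrite h eqxx in x0.
Qed.

Section directed_gauge.
Variable K : set V.
Hypotheses (K0 : K !=set0) (Kinner : K `<=` inner C u) (Kdir : up_directed C K).

Lemma gauge_epigraph : epigraph (gauge_epi C K).
Proof.
split.
- move=> y; have [k Kk] := K0; have [l l0 hl] := inner_bound y (Kinner Kk).
  by exists l; split=> //; exists k.
- by move=> y; exists 0 => mu [].
- move=> a b mu nu [mu0 [k Kk hk]] [nu0 [k' Kk' hk']]; exists (mu + nu) => //.
  split; first exact: addr_ge0.
  have [z Kz [zk zk']] := Kdir Kk Kk'; exists z => //.
  have h1 := ucD hC hk (ucZ hC mu0 zk); have h2 := ucD hC hk' (ucZ hC nu0 zk').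
  by apply: uc_eq (ucD hC h1 h2) _; module_eq R.
- move=> l a mu l0 [mu0 [k Kk hk]]; exists (l * mu) => //.
  split; first by apply: mulr_ge0 => //; exact: ltW.
  by exists k => //; apply: uc_eq (ucZ hC (ltW l0) hk) _; module_eq R.
Qed.

Lemma gauge_minorantP phi : minorant (epi_inf (gauge_epi C K)) phi <->
  positive_functional C phi /\ forall k, K k -> phi k <= 1.
Proof.
have epi := gauge_epigraph; split=> [[lin le]|[[lin pos] le1]].
  split; last first.
    move=> k Kk; apply: le_trans (le k) _; apply: epi_inf_le => //.
    by split=> //; exists k => //; rewrite scale1r subrr; exact: uc0.
  split=> // x Cx; have := le (- x); rewrite scalfN //.
  suff : epi_inf (gauge_epi C K) (- x) <= 0 by lra.
  apply: epi_inf_le => //; split=> //; have [k Kk] := K0; exists k => //.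
  by rewrite scale0r sub0r opprK.
split=> // y; apply: le_epi_inf => // mu [mu0 [k Kk hk]].
have : phi y <= phi (mu *: k) by apply: functional_le.
by rewrite scalfZ //; have := le1 _ Kk; nra.
Qed.

(** The linear minorants form a cap of the dual cone: the supremum over [K] is
    an additive function of positive functionals, and they are its sublevel set
    of level 1.  Hence the extreme minorants generate extreme rays. *)
Lemma extreme_gauge_minorant phi y : extreme_minorant (epi_inf (gauge_epi C K)) phi ->
  phi y != 0 -> extreme_functional C phi.
Proof.
move=> [/gauge_minorantP [[lin pos] le1] ext] phiy; split=> //; first by exists y.
move=> phi1 [lin1 pos1] phi1le.
pose phi2 x := phi x - phi1 x.
have lin2 : scalar phi2 by move=> l a b; rewrite /phi2 lin lin1; ring.
have pos2 x : C x -> 0 <= phi2 x by move=> /phi1le; rewrite /phi2 subr_ge0.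
(* [s] is the value at [phi1] of the additive function that defines the cap; the
   value at [phi2] is then at most [1 - s]. *)
pose S := [set phi1 k | k in K]; pose s := sup S.
have ubS : has_ubound S.
  exists 1 => _ [k Kk <-]; apply: le_trans (le1 _ Kk).
  exact: phi1le (inner_in (Kinner Kk)).
have S0 : S !=set0 by have [k Kk] := K0; exists (phi1 k); exists k.
have phi1s k : K k -> phi1 k <= s by move=> Kk; apply: ub_le_sup => //; exists k.
have phi2s k : K k -> phi2 k <= 1 - s.
  move=> Kk; suff : s <= 1 - phi2 k by lra.
  apply: ge_sup => // _ [k' Kk' <-].
  have [z Kz [zk zk']] := Kdir Kk Kk'; have := le1 _ Kz.
  have := functional_le (conj lin1 pos1) zk'; have := functional_le (conj lin2 pos2) zk.
  by rewrite /phi2; lra.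
have [k0 Kk0] := K0; have ik0 := Kinner Kk0.
have s0 : 0 <= s by apply: le_trans (phi1s _ Kk0); apply: pos1; exact: inner_in.
have s1 : s <= 1 by have := pos2 _ (inner_in ik0); have := phi2s _ Kk0; lra.
have [sle|sgt] := leP s 0.
  have h := functional_eq0 (conj lin1 pos1) ik0 (le_trans (phi1s _ Kk0) sle).
  by exists 0 => x; rewrite h mul0r.
have [sge|slt] := leP 1 s.
  have le0 : phi2 k0 <= 0 by have := phi2s _ Kk0; lra.
  have h := functional_eq0 (conj lin2 pos2) ik0 le0.
  by exists 1 => x; have := h x; rewrite /phi2; lra.
have [||||phi1E _] := ext s (fun x => s^-1 * phi1 x) (fun x => (1 - s)^-1 * phi2 x).
- by rewrite sgt slt.
- apply/gauge_minorantP; split; first split.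
  + by move=> l a b; rewrite lin1; ring.
  + by move=> x Cx; rewrite mulr_ge0 ?invr_ge0 // pos1.
  + by move=> k Kk; rewrite mulrC ler_pdivrMr // mul1r phi1s.
- apply/gauge_minorantP; split; first split.
  + by move=> l a b; rewrite lin2; ring.
  + by move=> x Cx; apply: mulr_ge0; [rewrite invr_ge0 subr_ge0|exact: pos2].
  + by move=> k Kk; rewrite mulrC ler_pdivrMr ?subr_gt0 // mul1r phi2s.
- by apply/funext => x; rewrite /conv_comb /phi2; field; lra.
exists s => x; rewrite -phi1E; field; lra.
Qed.

Lemma exists_extreme_functional y : 0 < epi_inf (gauge_epi C K) y ->
  exists2 phi, extreme_functional C phi &
    forall k, K k -> phi k <= 1.
Proof.
move=> y0; have [phi ext phiy] :=
  exists_extreme_minorant y (epi_inf_sublinear gauge_epigraph).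
exists phi; first by apply: (extreme_gauge_minorant ext (y := y)); rewrite phiy gt_eqF.
by have [/gauge_minorantP []] := ext.
Qed.

End directed_gauge.

Lemma exists_extreme_functional_lt0 x : ~ C x ->
  exists2 phi, extreme_functional C phi & phi x < 0.
Proof.
move=> Cx; have K0 : [set u] !=set0 by exists u.
have Ki : [set u] `<=` inner C u by move=> _ ->; exact: inner_unit.
have Kd : up_directed C [set u].
  by move=> _ _ -> ->; exists u => //; rewrite subrr; split; exact: uc0.
have epi := gauge_epigraph K0 Ki Kd.
have pos : 0 < epi_inf (gauge_epi C [set u]) (- x).
  rewrite ltNge; apply/negP => le; apply: Cx; apply: (uc_closed hC) => e e0.
  have [mu [mu0 [_ -> h]] mue] := epi_inf_lt epi (le_lt_trans le e0).
  by apply: uc_eq (inner_leZ inner_unit (ltW mue) h) _; module_eq R.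
have [phi ext phix] := exists_extreme_minorant (- x) (epi_inf_sublinear epi).
have phi0 : phi (- x) != 0 by rewrite phix gt_eqF.
exists phi; first exact: (extreme_gauge_minorant K0 Ki Kd ext phi0).
have [[lin _] _] := ext.
by move: pos; rewrite -phix scalfN // oppr_gt0.
Qed.

(** A linear functional on [V * V] below the infimum of [phi] over the common upper
    bounds of [a] and [b] has two positive components, of sum [phi] on the diagonal;
    [phi] being extreme, it is [l * phi a + (1 - l) * phi b] with [0 <= l <= 1].  By
    Hahn-Banach the infimum at [(k1, k2)] is a value of this kind, and so less
    than 1. *)
Lemma extreme_functional_sublevel_directed phi : extreme_functional C phi ->
  up_directed C [set k | phi k < 1].
Proof.
move=> ephi k1 k2 /= lt1 lt2; have [[lin pos] [x0 phix0] ext] := ephi.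
pose E (a : (V * V)%type) mu := exists2 c, C (c - a.1) /\ C (c - a.2) & phi c <= mu.
have epi : epigraph E.
  split.
  - move=> [a b]; have [l l0 hl] := inner_bound a inner_unit.
    have [l' l'0 hl'] := inner_bound b inner_unit.
    exists (phi ((l + l') *: u)); exists ((l + l') *: u) => //=; split.
      by apply: uc_eq (ucD hC hl (ucZ hC l'0 (uc_unit hC))) _; module_eq R.
    by apply: uc_eq (ucD hC hl' (ucZ hC l0 (uc_unit hC))) _; module_eq R.
  - move=> [a b]; exists (phi a) => mu [c [/= ca _]]; apply: le_trans.
    exact: functional_le.
  - move=> [a b] [a' b'] mu nu [c /= [ca cb] cmu] [c' /= [ca' cb'] cnu].
    exists (mu + nu) => //; exists (c + c'); last by rewrite scalfD // lerD.
    split=> /=.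
      by apply: uc_eq (ucD hC ca ca') _; module_eq R.
    by apply: uc_eq (ucD hC cb cb') _; module_eq R.
  - move=> l [a b] mu l0 [c /= [ca cb] cmu]; exists (l * mu) => //.
    exists (l *: c); last by rewrite scalfZ // ler_pM2l.
    by split=> /=; rewrite -scalerBr; apply: (ucZ hC) => //; exact: ltW.
have [Phi [[linP lePhi] _] PhiE] := exists_extreme_minorant (k1, k2) (epi_inf_sublinear epi).
have PhiD a b : Phi (a, b) = Phi (a, 0) + Phi (0, b).
  by rewrite -scalfD //; congr Phi; apply/pair_equal_spec; rewrite /= addr0 add0r.
have neg a b : C (- a) -> C (- b) -> Phi (a, b) <= 0.
  move=> Ca Cb; apply: le_trans (lePhi _) _; apply: epi_inf_le => //.
  by exists 0; rewrite ?scalf0 // !sub0r.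
have diag a : Phi (a, 0) + Phi (0, a) <= phi a.
  rewrite -PhiD; apply: le_trans (lePhi _) _; apply: epi_inf_le => //.
  by exists a => //=; rewrite subrr; split; exact: uc0.
have lin1 : scalar (fun a => Phi (a, 0)).
  move=> l a b; rewrite -(linP l (a, 0) (b, 0)); congr Phi.
  by apply/pair_equal_spec; rewrite /= scaler0 addr0.
have lin2 : scalar (fun a => Phi (0, a)).
  move=> l a b; rewrite -(linP l (0, a) (0, b)); congr Phi.
  by apply/pair_equal_spec; rewrite /= scaler0 addr0.
have C0 : C (- 0) by rewrite oppr0; exact: uc0.
have pos1 x : C x -> 0 <= Phi (x, 0).
  move=> Cx; have : Phi (- x, 0) <= 0 by apply: neg => //; rewrite opprK.
  by rewrite (scalfN x lin1) oppr_le0.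
have pos2 x : C x -> 0 <= Phi (0, x).
  move=> Cx; have : Phi (0, - x) <= 0 by apply: neg => //; rewrite opprK.
  by rewrite (scalfN x lin2) oppr_le0.
have [|l hl] := ext _ (conj lin1 pos1).
  by move=> x Cx; have := diag x; have := pos2 _ Cx; lra.
have phi2E x : Phi (0, x) = (1 - l) * phi x.
  suff : phi x - Phi (x, 0) - Phi (0, x) = 0 by rewrite hl; lra.
  have := diag x; have := diag (- x).
  by rewrite scalfN // (scalfN x lin1) (scalfN x lin2); lra.
have u0 := extreme_functional_gt0 ephi inner_unit.
have l0 : 0 <= l by have := pos1 _ (uc_unit hC); rewrite hl pmulr_lge0.
have l1 : l <= 1.
  by have := pos2 _ (uc_unit hC); rewrite phi2E pmulr_lge0 // subr_ge0.
have lt : epi_inf E (k1, k2) < 1.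
  rewrite -PhiE PhiD hl phi2E.
  have h2 : 0 <= (1 - l) * (1 - phi k2) by rewrite mulr_ge0 // subr_ge0 // ltW.
  have [le0|gt0] := leP l 0.
    have -> : l = 0 by apply/eqP; rewrite eq_le le0.
    by rewrite mul0r subr0 mul1r add0r.
  have h1 : 0 < l * (1 - phi k1) by rewrite mulr_gt0 // subr_gt0.
  by lra.
have [mu [c [ck1 ck2] cmu] mult] := epi_inf_lt epi lt.
by exists c => //=; exact: le_lt_trans cmu mult.
Qed.

(** The extreme functionals of a cone determine its order, and they are multiples
    of states. *)
Lemma states_order x : (forall xi, states C u xi -> 0 <= xi x) -> C x.
Proof.
move=> h; apply: contrapT => /exists_extreme_functional_lt0 [phi ephi phix].
have phiu := extreme_functional_gt0 ephi inner_unit.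
have [[lin pos] _ _] := ephi.
have /h : states C u (fun y => (phi u)^-1 * phi y).
  split=> [l a b|v Cv|]; first by rewrite lin; ring.
    by rewrite mulr_ge0 ?pos // invr_ge0 ltW.
  by rewrite mulVf // gt_eqF.
by rewrite pmulr_rge0 ?invr_gt0 // leNgt phix.
Qed.

Lemma states_bound xi x (l : R) : states C u xi -> C (l *: u - x) -> xi x <= l.
Proof. by move=> [lin pos xiu] /pos; rewrite scalfB // scalfZ // xiu; lra. Qed.

(** Dini's theorem on the state space.  If no element of [A] is below [r + eps u]
    then [- u] is not in the convex cone generated by [C] and the vectors
    [w - r - eps u], so some state is nonnegative on all of these. *)
Lemma states_dini (A : set V) r (eps : R) : A !=set0 -> down_directed C A ->
  0 < eps ->
  (forall xi, states C u xi -> exists2 w, A w & xi w < xi r + eps) ->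
  exists2 w, A w & C (r + eps *: u - w).
Proof.
move=> A0 Adir eps0 lim; apply: contrapT => noA.
pose E y mu := exists2 t : R, 0 <= t &
  exists2 w, A w & C (mu *: u - (y + t *: (w - r - eps *: u))).
have epi : epigraph E.
  split.
  - move=> y; have [w Aw] := A0; have [l l0 hl] := inner_bound y inner_unit.
    exists l, 0 => //; exists w => //.
    by rewrite scale0r addr0.
  - move=> y; have [l l0 hl] := uc_bound hC y; exists (- l) => mu [t t0 [w Aw h]].
    rewrite leNgt; apply/negP => mul.
    have h' := ucD hC h hl.
    have [t00|tgt] := leP t 0.
      have t0E : t = 0 by apply/eqP; rewrite eq_le t00.
      have : C (- ((- mu - l) *: u)).
        by apply: uc_eq h' _; rewrite t0E; module_eq R.
      by move/uc_unitN; lra.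
    have dk : 0 <= - mu - l by lra.
    have tV : 0 <= t^-1 by rewrite invr_ge0.
    apply: noA; exists w => //.
    apply: uc_eq (ucZ hC tV (ucD hC h' (ucZ hC dk (uc_unit hC)))) _.
    by module_eq R; field; lra.
  - move=> a b mu nu [s s0 [w Aw h]] [t t0 [w' Aw' h']]; exists (mu + nu) => //.
    have [z Az [wz w'z]] := Adir _ _ Aw Aw'.
    exists (s + t); first exact: addr_ge0.
    exists z => //.
    have h1 := ucD hC h (ucZ hC s0 wz); have h2 := ucD hC h' (ucZ hC t0 w'z).
    by apply: uc_eq (ucD hC h1 h2) _; module_eq R.
  - move=> l a mu l0 [t t0 [w Aw h]]; exists (l * mu) => //.
    exists (l * t); first by apply: mulr_ge0 => //; exact: ltW.
    by exists w => //; apply: uc_eq (ucZ hC (ltW l0) h) _; module_eq R.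
have [xi [[lin le] _] _] := exists_extreme_minorant u (epi_inf_sublinear epi).
have [w0 Aw0] := A0.
have xile y (mu : R) : C (mu *: u - y) -> xi y <= mu.
  move=> h; apply: le_trans (le y) _; apply: epi_inf_le => //.
  by exists 0 => //; exists w0 => //; rewrite scale0r addr0.
have xiS : states C u xi.
  split=> // [v Cv|].
    rewrite -oppr_le0 -scalfN //; apply: xile.
    by apply: uc_eq Cv _; module_eq R.
  apply/eqP; rewrite eq_le; apply/andP; split.
    by apply: xile; rewrite scale1r subrr; exact: uc0.
  rewrite -lerN2 -scalfN //; apply: xile.
  by apply: uc_eq uc0 _; module_eq R.
have [w Aw] := lim _ xiS; apply/negP; rewrite -leNgt.
have : xi (- (w - r - eps *: u)) <= 0.
  apply: le_trans (le _) _; apply: epi_inf_le => //.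
  exists 1 => //; exists w => //.
  by apply: uc_eq uc0 _; module_eq R.
have [_ _ xiu] := xiS.
by rewrite (scalfN _ lin) !(scalfB _ _ lin) (scalfZ _ _ lin) xiu; lra.
Qed.

End unital_cone.

(** * Order unit spaces and directed infima *)

Lemma order_unit_space_unital (R : realType) (V : normedModType R) (C : set V)
    (u : V) : order_unit_space C u -> u != 0 -> unital_cone C u.
Proof.
move=> hC u0; have scC := cone_scale hC; split=> //.
- move=> x y Cx Cy.
  have : C (2 *: (2^-1 *: x + (1 - 2^-1) *: y)).
    by apply: scC => //; apply: (cone_convex hC) => //; lra.
  by move=> h; apply: uc_eq h _; module_eq R; field.
- by move=> x Cx CNx; apply/(cone_pointed hC).
- move=> x h; suff : cone_le C (- x) 0 by rewrite /cone_le sub0r opprK.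
  apply: (cone_archimedean hC (order_unit_in hC)) => n; rewrite /cone_le.
  have [->|n0] := eqVneq n 0%N; first by rewrite scale0r subr0; exact: order_unit_in hC.
  have nR : 0 < n%:R :> R by rewrite ltr0n lt0n.
  have nV : 0 < (n%:R)^-1 :> R by rewrite invr_gt0.
  apply: uc_eq (scC _ _ (ltW nR) (h _ nV)) _; module_eq R.
  by field; lra.
- exact: order_unit_in hC.
- move=> x; have [l [l0 + _]] := order_unitP hC x; rewrite /cone_le => h; exists l => //.
  by apply: uc_eq h _; module_eq R.
Qed.

Lemma interior_inner (R : realType) (V : normedModType R) (C : set V) (u : V) :
  order_unit_space C u -> u != 0 -> C° = inner C u.
Proof.
move=> hC u0; have uc := order_unit_space_unital hC u0.
apply/seteqP; split=> x.
  move=> /nbhs_ballP [d /= d0 hd].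
  have nu0 : 0 < `|u| by rewrite normr_gt0.
  have k0 : 0 < d / 2 / `|u| by rewrite !divr_gt0.
  exists (d / 2 / `|u|) => //; apply: hd; rewrite -ball_normE /=.
  rewrite opprB addrC subrK normrZ gtr0_norm // divfK ?gt_eqF //; lra.
move=> [d d0 hd]; apply/nbhs_ballP; exists d => //= y; rewrite -ball_normE /=.
rewrite (normE_order_unit hC) => lt.
have [|l [l0 _ +] ld] := inf_lt _ lt.
  by have [l hl] := order_unitP hC (x - y); exists l.
rewrite /cone_le => hl; have dl : 0 <= d - l by rewrite subr_ge0 ltW.
have h := ucZ uc dl (uc_unit uc).
by apply: uc_eq (ucD uc (ucD uc hd hl) h) _; module_eq R.
Qed.

Definition directed_infima (R : realType) (V : lmodType R) (C : set V) (u : V) : Prop :=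
  forall A : set V, A !=set0 -> A `<=` C -> down_directed C A ->
  exists2 r, C r & (forall w, A w -> C (w - r)) /\
    forall eps : R, 0 < eps -> exists2 w, A w & C (r + eps *: u - w).

Lemma near_within_eval_lt (R : realType) (T : eqType) (S : set (T -> R))
    (g : (T -> R) -> R) (w : T) (xi : T -> R) (a : R) :
  (forall z, S z -> g z <= z w) -> xi w < a ->
  \forall z \near within S (nbhs (xi : {ptws T -> R})), g z < a.
Proof.
move=> gle lt; rewrite near_withinE.
have ev := @proj_continuous T (fun=> R) w xi _ (lt_nbhsl lt).
have F : Filter (nbhs (xi : {ptws T -> R})) by exact: nbhs_filter.
refine (@filterS _ _ F _ _ _ ev).
by move=> z /= zw /gle /le_lt_trans; exact.
Qed.

(** The pointwise infimum of a downward directed subset of [C] is a nonnegative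
    bounded affine upper semi-continuous function on the states, hence it comes
    from an element of [C]; by Dini's theorem the convergence is in norm. *)
Lemma csc_directed_infima (R : realType) (V : lmodType R) (C : set V) (u : V) :
  unital_cone C u -> cone_functions C u = Csc C u -> directed_infima C u.
Proof.
move=> hC hsc A [w0 Aw0] AC Adir.
pose g (xi : V -> R) := inf [set xi w | w in A].
have lb xi : states C u xi -> has_lbound [set xi w | w in A].
  by move=> [lin pos _]; exists 0 => _ [w Aw <-]; exact/pos/AC.
have g_le xi w : states C u xi -> A w -> g xi <= xi w.
  by move=> sxi Aw; apply: ge_inf; [exact: lb|by exists w].
have le_g xi m : (forall w, A w -> m <= xi w) -> m <= g xi.
  by move=> h; apply: lb_le_inf; [by exists (xi w0), w0|move=> _ [w Aw <-]; exact: h].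
have g_lt xi m : g xi < m -> exists2 w, A w & xi w < m.
  move=> lt; have [|_ [w Aw <-] wm] := inf_lt _ lt; first by exists (xi w0), w0.
  by exists w.
have g0 xi : states C u xi -> 0 <= g xi.
  by move=> [lin pos _]; apply: le_g => w /AC; exact: pos.
have [l l0 hl] := inner_bound hC w0 (inner_unit hC).
have gl xi : states C u xi -> g xi <= l.
  by move=> sxi; apply: le_trans (g_le _ _ sxi Aw0) (states_bound sxi hl).
have cscg : Csc C u g.
  split; first exact: g0.
  exists g, (fun=> 0); split; last by move=> xi _; rewrite subr0.
    split; first exact: g0.
    - rewrite /bounded_near; near=> M => xi /= sxi.
      rewrite ger0_norm ?g0 //; apply: le_trans (gl _ sxi) _.
      by near: M; apply: nbhs_pinfty_ge; exact: num_real.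
    - move=> t xi1 xi2 /andP[t0 t1] s1 s2; apply/eqP; rewrite eq_le; apply/andP; split.
        apply/ler_addgt0Pl => d d0.
        have [|w1 Aw1 lt1] := g_lt xi1 (g xi1 + d); first by rewrite ltrDl.
        have [|w2 Aw2 lt2] := g_lt xi2 (g xi2 + d); first by rewrite ltrDl.
        have [w Aw [ww1 ww2]] := Adir _ _ Aw1 Aw2.
        have sc : states C u (conv_comb t xi1 xi2).
          move: s1 s2 => [lin1 pos1 e1] [lin2 pos2 e2]; split.
          + by move=> k a b; rewrite /conv_comb lin1 lin2; ring.
          + by move=> v Cv; rewrite addr_ge0 // mulr_ge0 ?subr_ge0 ?pos1 ?pos2.
          + by rewrite /conv_comb e1 e2; ring.
        apply: le_trans (g_le _ _ sc Aw) _; rewrite /conv_comb.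
        have h1 : xi1 w <= g xi1 + d.
          apply: le_trans (ltW lt1); move: s1 => [lin1 pos1 _].
          exact: functional_le (conj lin1 pos1) ww1.
        have h2 : xi2 w <= g xi2 + d.
          apply: le_trans (ltW lt2); move: s2 => [lin2 pos2 _].
          exact: functional_le (conj lin2 pos2) ww2.
        have := ler_wpM2l t0 h1; have t1' : 0 <= 1 - t by rewrite subr_ge0.
        by have := ler_wpM2l t1' h2; lra.
      apply: le_g => w Aw; rewrite /conv_comb lerD // ler_wpM2l ?subr_ge0 //.
        exact: g_le.
      exact: g_le.
    - move=> xi a sxi /g_lt [w Aw wa].
      by apply: near_within_eval_lt wa => z sz; exact: g_le.
  split=> //.
  - by exists 0; split=> // M M0 xi _; rewrite /= normr0 ltW.
  - by move=> t xi1 xi2 _ _ _; ring.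
  - move=> xi a [lin _ _] lt; apply: (@near_within_eval_lt _ _ _ _ 0).
      by move=> z [linz _ _]; rewrite scalf0.
    by rewrite scalf0.
have [r Cr rE] : cone_functions C u g by rewrite hsc.
have rg xi : states C u xi -> xi r = g xi by move=> /rE.
exists r => //; split=> [w Aw|eps eps0].
  apply: (states_order hC) => xi sxi; have [lin _ _] := sxi.
  by rewrite scalfB // subr_ge0 rg // g_le.
apply: (states_dini hC) => //; first by exists w0.
by move=> xi sxi; apply: g_lt; rewrite rg // ltrDl.
Unshelve. all: by end_near. Qed.

(** * Gauge-reversing maps *)

Section unital_cone_order.
Context {R : realType} {V : lmodType R} {C : set V} {u : V}.
Hypothesis hC : unital_cone C u.

(** The vector [d] spans an extreme ray as soon as its order interval is a chain:
    [s] is then the supremum of the multiples of [d] below it. *)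
Lemma chain_multiple d s : C s -> C (d - s) ->
  (forall l : R, 0 <= l <= 1 -> C (s - l *: d) \/ C (l *: d - s)) ->
  exists l : R, s = l *: d.
Proof.
move=> Cs Cds cmp.
have Cd : C d by apply: uc_eq (ucD hC Cs Cds) _; module_eq R.
pose S := [set l : R | 0 <= l <= 1 /\ C (s - l *: d)].
have S0 : S 0 by split; [lra|rewrite scale0r subr0].
have ubS : has_ubound S by exists 1 => l [/andP[]].
have Sle l : S l -> l <= sup S by move=> Sl; apply: ub_le_sup.
have l0 : 0 <= sup S by exact: Sle.
have l1 : sup S <= 1 by apply: ge_sup; [exists 0|move=> l [/andP[]]].
exists (sup S); apply: (uc_le_anti hC).
  apply: (closed_along hC Cd) => e e0; have [sle|sgt] := leP 1 (sup S + e).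
    have h : 0 <= sup S + e - 1 by lra.
    by apply: uc_eq (ucD hC Cds (ucZ hC h Cd)) _; module_eq R.
  have [h|h] := cmp (sup S + e) ltac:(lra).
    have /Sle : S (sup S + e) by split=> //; lra.
    by lra.
  by apply: uc_eq h _; module_eq R.
apply: (closed_along hC Cd) => e e0.
have [|l [/andP[l0' l1'] h] lt] := @sup_adherent _ S e e0; first by split=> //; exists 0.
have h' : 0 <= l - sup S + e by lra.
by apply: uc_eq (ucD hC h (ucZ hC h' Cd)) _; module_eq R.
Qed.

Lemma functional_le_inner phi psi : scalar phi -> scalar psi ->
  (forall x, inner C u x -> phi x <= psi x) -> forall x, C x -> phi x <= psi x.
Proof.
move=> linphi linpsi h x Cx; rewrite leNgt; apply/negP => lt.
have hu := h _ (inner_unit hC); set m := psi u - phi u; set d := phi x - psi x.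
have d0 : 0 < d by rewrite subr_gt0.
have m0 : 0 <= m by rewrite subr_ge0.
have e0 : 0 < d / (2 * (m + 1)) by apply: divr_gt0 => //; lra.
have := h _ (innerDZ hC Cx e0).
rewrite (scalfD _ _ linphi) (scalfZ _ _ linphi) (scalfD _ _ linpsi) (scalfZ _ _ linpsi).
have eE : d / (2 * (m + 1)) * (m + 1) = d / 2 by field; lra.
move: (d / _) e0 eE => e e0; rewrite /m /d; lra.
Qed.

(** Compare the two gauges relative to [r + eps u]. *)
Lemma gauge_order r s : C r ->
  (forall v (mu : R), inner C u v -> C (mu *: v - r) -> C (mu *: v - s)) -> C (r - s).
Proof.
move=> Cr h; apply: (uc_closed hC) => e e0.
apply: uc_eq (h (r + e *: u) 1 (innerDZ hC Cr e0) _) _; last by module_eq R.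
by apply: uc_eq (ucZ hC (ltW e0) (uc_unit hC)) _; module_eq R.
Qed.

End unital_cone_order.

Record gauge_reversal (R : realType) (V W : lmodType R) (C : set V) (u : V)
    (K : set W) (e : W) (Psi : V -> W) : Prop := GaugeReversal {
  gr_inner : forall v, inner C u v -> inner K e (Psi v);
  gr_surj : forall y, inner K e y -> exists2 v, inner C u v & Psi v = y;
  gr_le : forall v w (mu : R), inner C u v -> inner C u w ->
    C (mu *: w - v) <-> K (mu *: Psi v - Psi w)
}.

Section gauge_reversal.
Context {R : realType} {V W : lmodType R} {C : set V} {u : V} {K : set W} {e : W}.
Context {Psi : V -> W}.
Hypotheses (hC : unital_cone C u) (hK : unital_cone K e).
Hypothesis hPsi : gauge_reversal C u K e Psi.

Lemma gr_le1 v w : inner C u v -> inner C u w -> C (w - v) <-> K (Psi v - Psi w).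
Proof. by move=> iv iw; have := gr_le hPsi 1 iv iw; rewrite !scale1r. Qed.

Lemma gr_scale l v : 0 < l -> inner C u v -> Psi (l *: v) = l^-1 *: Psi v.
Proof.
move=> l0 iv; have ilv := innerZ hC l0 iv; have lV : 0 <= l^-1 by rewrite invr_ge0 ltW.
apply: (uc_le_anti hK).
  apply/(gr_le hPsi) => //; apply: uc_eq (uc0 hC) _.
  by module_eq R; field; lra.
have : K (l *: Psi (l *: v) - Psi v).
  by apply/(gr_le hPsi) => //; rewrite subrr; exact: uc0 hC.
move=> h; apply: uc_eq (ucZ hK lV h) _; module_eq R; field; lra.
Qed.

(** This says that [M(r/v) = phi (Psi v)], in terms of upper bounds. *)
Definition represents (phi : W -> R) (r : V) : Prop :=
  forall v, inner C u v -> forall mu : R, C (mu *: v - r) <-> phi (Psi v) <= mu.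

Lemma represents_inj phi r s : C r -> C s -> represents phi r -> represents phi s ->
  r = s.
Proof.
move=> Cr Cs hr hs; apply: (uc_le_anti hC).
  by apply: (gauge_order hC) => // v mu iv /(hs v iv) /(hr v iv).
by apply: (gauge_order hC) => // v mu iv /(hr v iv) /(hs v iv).
Qed.

Lemma represents_scale phi r l : 0 <= l -> represents phi r ->
  represents (fun y => l * phi y) (l *: r).
Proof.
rewrite le_eqVlt => /orP[/eqP <-|l0] hr v iv mu.
  rewrite scale0r subr0 mul0r; split=> [h|mu0]; last first.
    by apply: (ucZ hC) => //; exact: inner_in hC _ iv.
  rewrite leNgt; apply/negP => mu0.
  have muN : 0 < - mu by rewrite oppr_gt0.
  have imv := innerZ hC muN iv; move/eqP: (inner_neq0 hC imv); apply.
  apply: (uc_anti hC); first exact: inner_in hC _ imv.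
  by apply: uc_eq h _; module_eq R.
have lV : 0 < l^-1 by rewrite invr_gt0.
rewrite mulrC -ler_pdivlMr //; apply: iff_trans (hr v iv (mu / l)); split=> h.
  by apply: uc_eq (ucZ hC (ltW lV) h) _; module_eq R; field; lra.
by apply: uc_eq (ucZ hC (ltW l0) h) _; module_eq R; field; lra.
Qed.

Section directed_infima.
Hypothesis dinf : directed_infima C u.

(** The sublevel set of [phi] at height 1 being directed upward, the interior
    points [w] with [phi (Psi w) < 1] are directed downward; their infimum is the
    vector sought, because [phi (Psi v)] is the infimum of the gauges relative
    to [v] of these points. *)
Lemma exists_represented phi : extreme_functional K phi ->
  exists2 r, C r & represents phi r.
Proof.
move=> ephi; have [pphi _ _] := ephi; have [lin pos] := pphi.
have phi0 v : inner C u v -> 0 < phi (Psi v).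
  by move=> iv; apply: (extreme_functional_gt0 hK ephi); exact: gr_inner hPsi _ iv.
pose A := [set w | inner C u w /\ phi (Psi w) < 1].
have AP l v : inner C u v -> phi (Psi v) < l -> A (l *: v).
  move=> iv lt; have l0 := lt_trans (phi0 v iv) lt; split; first exact: innerZ.
  by rewrite gr_scale // scalfZ // mulrC ltr_pdivrMr // mul1r.
have iu := inner_unit hC.
have A0 : A !=set0.
  by exists ((phi (Psi u) + 1) *: u); apply: AP => //; rewrite ltrDl.
have AC : A `<=` C by move=> w [iw _]; exact: inner_in hC _ iw.
have Adir : down_directed C A.
  move=> w1 w2 [iw1 lt1] [iw2 lt2].
  have [c /= clt [c1 c2]] := extreme_functional_sublevel_directed hK ephi lt1 lt2.
  have ic : inner K e c := inner_le hK (gr_inner hPsi iw1) c1.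
  have [z iz zc] := gr_surj hPsi ic; exists z; first by split; rewrite ?zc.
  by split; apply/gr_le1; rewrite ?zc.
have [r Cr [rA rinf]] := dinf A0 AC Adir.
exists r => // v iv mu; split=> [h|le].
  apply/ler_addgt0Pl => d d0; rewrite addrC.
  have [k k0 hk] := iv; have dk0 : 0 < d * k by apply: mulr_gt0.
  have [w [iw wlt] hw] := rinf _ dk0.
  have h1 : C ((mu + d) *: v - w).
    apply: uc_eq (ucD hC (ucD hC h (ucZ hC (ltW d0) hk)) hw) _.
    by module_eq R.
  have md0 := inner_gt0 hC iv (inner_in hC iw) (inner_neq0 hC iw) h1.
  have : phi (Psi v) <= phi ((mu + d) *: Psi w).
    by apply: (functional_le pphi); apply/(gr_le hPsi).
  by rewrite scalfZ //; have := phi0 _ iw; nra.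
apply: (inner_closed_le hC iv) => nu munu.
by apply: rA; apply: AP => //; exact: le_lt_trans le munu.
Qed.

(** When [s] is on the boundary of [C] these points, which increase as [d] decreases,
    stand for the image of [s]: the gauge of [Psi v] relative to them tends to
    [M(s/v)]. *)
Definition shifted_images (s : V) : set W :=
  [set y | exists2 d : R, 0 < d & y = Psi (s + d *: u)].

Lemma shifted_images_neq0 s : shifted_images s !=set0.
Proof. by exists (Psi (s + 1 *: u)); exists 1. Qed.

Lemma shifted_images_inner s : C s -> (shifted_images s `<=` inner K e)%classic.
Proof. by move=> Cs _ [d d0 ->]; apply: (gr_inner hPsi); exact: innerDZ. Qed.

Lemma shifted_images_directed s : C s -> up_directed K (shifted_images s).
Proof.
move=> Cs _ _ [d d0 ->] [d' d'0 ->].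
have m0 : 0 < Num.min d d' by rewrite lt_min d0.
have le k : 0 < k -> Num.min d d' <= k ->
    K (Psi (s + Num.min d d' *: u) - Psi (s + k *: u)).
  move=> k0 mk; apply/gr_le1; [exact: innerDZ|exact: innerDZ|].
  have km : 0 <= k - Num.min d d' by rewrite subr_ge0.
  by apply: uc_eq (ucZ hC km (uc_unit hC)) _; module_eq R.
exists (Psi (s + Num.min d d' *: u)); first by exists (Num.min d d').
by split; apply: le => //; rewrite ge_min lexx ?orbT.
Qed.

Let gauge_fun s := epi_inf (gauge_epi K (shifted_images s)).

Lemma gauge_epigraph_shifted s : C s -> epigraph (gauge_epi K (shifted_images s)).
Proof.
move=> Cs; apply: (gauge_epigraph hK (shifted_images_neq0 s)).
  exact: shifted_images_inner.
exact: shifted_images_directed.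
Qed.

Lemma gauge_fun_le s v mu : C s -> inner C u v ->
  gauge_fun s (Psi v) <= mu <-> C (mu *: v - s).
Proof.
move=> Cs iv; have epi := gauge_epigraph_shifted Cs; split=> h.
  apply: (inner_closed_le hC iv) => nu munu.
  have [k [k0 [_ [d d0 ->] hk]] klt] := epi_inf_lt epi (le_lt_trans h munu).
  apply: (inner_leZ hC iv (ltW klt)).
  have /(gr_le hPsi k iv) hk' : inner C u (s + d *: u) by exact: innerDZ.
  have isd : inner C u (s + d *: u) by exact: innerDZ.
  have {}hk := (gr_le hPsi k isd iv).2 hk.
  by apply: uc_eq (ucD hC hk (ucZ hC (ltW d0) (uc_unit hC))) _; module_eq R.
apply/ler_addgt0Pl => d d0; rewrite addrC.
have [k k0 hk] := iv; have dk0 : 0 < d * k by apply: mulr_gt0.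
have isd : inner C u (s + (d * k) *: u) by exact: innerDZ.
have h1 : C ((mu + d) *: v - (s + (d * k) *: u)).
  by apply: uc_eq (ucD hC h (ucZ hC (ltW d0) hk)) _; module_eq R.
apply: epi_inf_le => //; split.
  exact: ltW (inner_gt0 hC iv (inner_in hC isd) (inner_neq0 hC isd) h1).
exists (Psi (s + (d * k) *: u)); first by exists (d * k).
exact/(gr_le hPsi).
Qed.

Lemma exists_represented_below z : C z -> z != 0 ->
  exists2 phi, extreme_functional K phi & exists2 r, C r /\ C (z - r) & represents phi r.
Proof.
move=> Cz z0; have iu := inner_unit hC.
have pos : 0 < gauge_fun z (Psi u).
  rewrite ltNge; apply/negP => /(gauge_fun_le 0 Cz iu).
  by rewrite scale0r sub0r => CNz; move/eqP: z0; apply; exact: (uc_anti hC).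
have [phi ephi phi1] := exists_extreme_functional hK (shifted_images_neq0 z)
  (shifted_images_inner Cz) (shifted_images_directed Cz) pos.
exists phi => //; have [r Cr hr] := exists_represented ephi.
exists r => //; split=> //; apply: (uc_closed hC) => d d0.
have izd := innerDZ hC Cz d0.
have : phi (Psi (z + d *: u)) <= 1 by apply: phi1; exists d.
by move/(hr _ izd); rewrite scale1r => h; apply: uc_eq h _; module_eq R.
Qed.

(** If [s <= r] then the gauge of [s], carried over to [K], is a sublinear
    function below [phi]; all its linear minorants are multiples of [phi], hence
    so is the function itself. *)
Lemma represented_extreme phi r : extreme_functional K phi -> C r ->
  represents phi r -> extreme_vector C r.
Proof.
move=> ephi Cr hr; have [pphi _ ext] := ephi; have [lin pos] := pphi.
have phi0 y : inner K e y -> 0 < phi y by move=> iy; exact: (extreme_functional_gt0 hK ephi iy).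
have iu := inner_unit hC; have ie := inner_unit hK.
split=> //.
  apply/eqP => r0; have := phi0 _ (gr_inner hPsi iu); apply/negP; rewrite -leNgt.
  by apply/(hr _ iu); rewrite r0 subr0 scale0r; exact: uc0 hC.
move=> s; rewrite /cone_le subr0 => Cs sr.
have epi := gauge_epigraph_shifted Cs.
have mult psi : minorant (gauge_fun s) psi -> exists l, forall y, psi y = l * phi y.
  move=> mpsi; have [linpsi le] := mpsi.
  have [ppsi _] := (gauge_minorantP hK (shifted_images_neq0 s)
    (shifted_images_inner Cs) (shifted_images_directed Cs) psi).1 mpsi.
  apply: ext => //; apply: (functional_le_inner hK) => // y iy.
  have [v iv <-] := gr_surj hPsi iy; apply: le_trans (le _) _.
  apply/gauge_fun_le => //; apply: (uc_trans hC) (_ : C (_ - r)); last exact/hr.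
  by apply: uc_eq sr _.
have touch y : inner K e y -> exists2 l,
    forall x, l * phi x <= gauge_fun s x & l * phi y = gauge_fun s y.
  move=> iy; have [psi [mpsi _] psiy] := exists_extreme_minorant y (epi_inf_sublinear epi).
  have [l psiE] := mult _ mpsi.
  by exists l => [x|]; rewrite -psiE //; exact: mpsi.2.
have [l lle lE] := touch e ie.
have GE y : inner K e y -> gauge_fun s y = l * phi y.
  move=> iy; have [k kle kE] := touch y iy.
  have : k * phi e <= l * phi e by rewrite lE.
  have : l * phi y <= k * phi y by rewrite kE.
  by rewrite !ler_pM2r ?phi0 // -kE => h1 h2; congr (_ * _); apply/le_anti/andP.
have l0 : 0 <= l.
  rewrite -(pmulr_lge0 _ (phi0 _ ie)) -GE //.
  by apply: le_epi_inf => // mu [].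
exists l => //; apply: (@represents_inj (fun y => l * phi y)) => //.
- exact: (ucZ hC).
- move=> v iv mu; rewrite -GE; last exact: gr_inner hPsi _ iv.
  by apply: iff_sym; exact: gauge_fun_le.
- exact: represents_scale.
Qed.

Lemma extreme_vector_below z : C z -> z != 0 ->
  exists2 r, extreme_vector C r & C (z - r).
Proof.
move=> Cz z0; have [phi ephi [r [Cr zr] hr]] := exists_represented_below Cz z0.
by exists r => //; exact: represented_extreme hr.
Qed.

(** An extreme vector is a multiple of the represented vectors below it. *)
Lemma extreme_vector_represented p : extreme_vector C p ->
  exists2 phi, positive_functional K phi & represents phi p.
Proof.
move=> [p0 Cp ext]; have [phi ephi [r [Cr pr] hr]] := exists_represented_below Cp p0.
have [r0 _ _] := represented_extreme ephi Cr hr.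
have [|l l0 rE] := ext r _ pr; first by rewrite /cone_le subr0.
have lgt : 0 < l.
  rewrite lt_neqAle l0 andbT; apply/eqP => l00.
  by move: r0; rewrite rE -l00 scale0r eqxx.
have lV : 0 <= l^-1 by rewrite invr_ge0.
have [[lin pos] _ _] := ephi.
exists (fun y => l^-1 * phi y).
  by split=> [k a b|y Ky]; [rewrite lin; ring|rewrite mulr_ge0 ?pos].
rewrite (_ : p = l^-1 *: r); first exact: represents_scale.
by rewrite rE scalerA mulVf ?scale1r // gt_eqF.
Qed.

(** The extreme functionals determine the order of [K], and on the image of
    [Psi] they are the gauges of extreme vectors. *)
Lemma extreme_gauge_order v w : inner C u v -> inner C u w ->
  (forall r (mu : R), extreme_vector C r -> C (mu *: v - r) -> C (mu *: w - r)) ->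
  C (w - v).
Proof.
move=> iv iw h; apply/gr_le1 => //; apply: contrapT.
move=> /(exists_extreme_functional_lt0 hK) [phi ephi].
have [[lin pos] _ _] := ephi; rewrite scalfB // subr_lt0; apply/negP; rewrite -leNgt.
have [r Cr hr] := exists_represented ephi.
by apply/(hr _ iw)/h; [exact: represented_extreme hr|exact/(hr _ iv)].
Qed.

End directed_infima.

(** The order interval between [a] and [a + c q] is a chain, and [Psi] reverses
    its order. *)
Lemma image_chain a c q s : inner C u a -> 0 <= c -> extreme_vector C q -> K s ->
  K (Psi a - Psi (a + c *: q) - s) ->
  exists l : R, s = l *: (Psi a - Psi (a + c *: q)).
Proof.
move=> ia c0 [q0 Cq ext] Ks; set b := a + c *: q; set d := _ - Psi b; move=> hs.
have ib : inner C u b by apply: innerD => //; exact: (ucZ hC).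
have Kd : K d by apply: uc_eq (ucD hK Ks hs) _; module_eq R.
(* By order reversal the points between [Psi b] and [Psi a] are images of points
   between [a] and [b], which lie on the ray from [a] along [q]. *)
have pre x : K x -> K (d - x) -> exists2 z : V, inner C u z /\ Psi z = Psi b + x &
    exists l : R, z - a = l *: q.
  move=> Kx Kdx; have ix : inner K e (Psi b + x).
    by apply: innerD => //; exact: gr_inner hPsi _ ib.
  have [z iz zE] := gr_surj hPsi ix; exists z => //.
  have az : C (z - a).
    by apply/gr_le1 => //; rewrite zE; apply: uc_eq Kdx _; rewrite /d; module_eq R.
  have zb : C (b - z).
    by apply/gr_le1 => //; rewrite zE; apply: uc_eq Kx _; module_eq R.
  have [c00|cgt] := leP c 0.
    have cE : c = 0 by apply/eqP; rewrite eq_le c00.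
    exists 0; rewrite scale0r; apply: (uc_anti hC) => //.
    by apply: uc_eq zb _; rewrite /b cE; module_eq R.
  have cV : 0 <= c^-1 by rewrite invr_ge0.
  have [||l l0 zl] := ext (c^-1 *: (z - a)).
  - by rewrite /cone_le subr0; exact: (ucZ hC).
  - by apply: uc_eq (ucZ hC cV zb) _; rewrite /b; module_eq R; field; lra.
  - by exists (c * l); rewrite -scalerA -zl scalerA mulfV ?scale1r // gt_eqF.
apply: (chain_multiple hK) => // l /andP[l0 l1].
have [z [iz zE] [m mE]] := pre s Ks hs.
have [||z' [iz' zE'] [m' mE']] := pre (l *: d).
- exact: (ucZ hK).
- have l1' : 0 <= 1 - l by rewrite subr_ge0.
  by apply: uc_eq (ucZ hK l1' Kd) _; module_eq R.
have [mm|mm] := leP m m'; [left|right].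
  have hm : 0 <= m' - m by rewrite subr_ge0.
  have : C (z' - z).
    apply: uc_eq (ucZ hC hm Cq) _; rewrite -[z'](subrK a) -[z](subrK a) mE mE'.
    by module_eq R.
  move=> /(gr_le1 iz iz'); rewrite zE zE' => h.
  by apply: uc_eq h _; module_eq R.
have hm : 0 <= m - m' by rewrite subr_ge0 ltW.
have : C (z - z').
  apply: uc_eq (ucZ hC hm Cq) _; rewrite -[z'](subrK a) -[z](subrK a) mE mE'.
  by module_eq R.
move=> /(gr_le1 iz' iz); rewrite zE zE' => h.
by apply: uc_eq h _; module_eq R.
Qed.

End gauge_reversal.

Arguments represents {R V W} C u Psi phi r.

(** * Atoms and the form they define *)

Lemma le0_small_multiples (R : realType) (d k : R) :
  (forall r, 0 < r <= 2^-1 -> d <= r * k) -> d <= 0.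
Proof.
move=> h; rewrite leNgt; apply/negP => d0.
have k0 : 0 < k by have := h 2^-1 ltac:(lra); lra.
have [le|lt] := leP (d / (2 * k)) 2^-1.
  have r0 : 0 < d / (2 * k) by apply: divr_gt0 => //; lra.
  have := h (d / (2 * k)); rewrite r0 le => /(_ isT).
  by rewrite (_ : d / (2 * k) * k = d / 2); [lra|field; lra].
move: lt; rewrite ltr_pdivlMr; last lra.
by have := h 2^-1 ltac:(lra); lra.
Qed.

(** A function of [t] that is affine in [(1 + t)^-1] and touches
    [t |-> (1 + t * x)^-1] from above at [0] has the same derivative there, which
    determines it. *)
Lemma affine_in_inverse (R : realType) (f : R -> R) (x : R) :
  f 0 = 1 ->
  (forall s r t, -1 < s -> s <= r -> r <= t ->
    (f s - f r) * ((1 + s)^-1 - (1 + t)^-1) =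
    ((1 + s)^-1 - (1 + r)^-1) * (f s - f t)) ->
  (forall r, -1 < r -> 1 <= f r * (1 + r * x)) ->
  forall t, -1 < t -> f t = 1 - t / (1 + t) * x.
Proof.
move=> f0 aff touch t t1.
(* An interval that contains [t] and a neighbourhood of 0. *)
pose s := Num.min (- 2^-1) t; pose t' := Num.max 1 t.
have s1 : -1 < s by rewrite lt_min t1 andbT; lra.
have s2 : s <= - 2^-1 by rewrite ge_min lexx.
have st : s <= t by rewrite ge_min lexx orbT.
have t'1 : 1 <= t' by rewrite le_max lexx.
have tt' : t <= t' by rewrite le_max lexx orbT.
have D0 : 0 < (1 + s)^-1 - (1 + t')^-1 by rewrite subr_gt0 ltf_pV2 ?posrE; lra.
pose b := (f s - f t') / ((1 + s)^-1 - (1 + t')^-1).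
have fE r : s <= r -> r <= t' -> f r = f s - b * ((1 + s)^-1 - (1 + r)^-1).
  move=> sr rt; have := aff s r t' s1 sr rt; rewrite /b => h.
  have -> : f r = f s - (f s - f r) by ring.
  congr (_ - _); apply: (mulIf (lt0r_neq0 D0)); rewrite h.
  by rewrite [RHS]mulrAC divfK ?lt0r_neq0 // mulrC.
have f0E : f s - b * (1 + s)^-1 = 1 - b.
  by have := fE 0; rewrite addr0 invr1 f0 => /(_ ltac:(lra) ltac:(lra)); lra.
have {}fE r : s <= r -> r <= t' -> f r = 1 - r / (1 + r) * b.
  move=> sr rt; rewrite fE //.
  have r1 : 1 + r != 0 by rewrite gt_eqF //; lra.
  have -> : r / (1 + r) = 1 - (1 + r)^-1 by field.
  by move: f0E; lra.
have ineq r : - 2^-1 <= r -> r <= 1 -> 0 <= r * (x - b + r * (x * (1 - b))).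
  move=> r1 r2; have := touch r ltac:(lra); rewrite fE; [|lra|lra] => h.
  have rp : 0 < 1 + r by lra.
  have := ler_pM2l rp 1 ((1 - r / (1 + r) * b) * (1 + r * x)); rewrite h => h'.
  suff : (1 + r) * 1 <= (1 + r - r * b) * (1 + r * x) by lra.
  rewrite (_ : (1 + r - r * b) * (1 + r * x) =
    (1 + r) * ((1 - r / (1 + r) * b) * (1 + r * x))) ?h' //.
  by field; lra.
have le1 : x - b <= 0.
  apply: (@le0_small_multiples _ _ (x * (1 - b))) => r /andP[r0 r1].
  by have := ineq (- r) ltac:(lra) ltac:(lra); nra.
have le2 : b - x <= 0.
  apply: (@le0_small_multiples _ _ (x * (1 - b))) => r /andP[r0 r1].
  by have := ineq r ltac:(lra) ltac:(lra); nra.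
by rewrite fE // (_ : b = x) //; lra.
Qed.

Section atoms.
Context {R : realType} {V W : lmodType R} {C : set V} {u : V} {K : set W} {e : W}.
Context {Psi : V -> W}.
Hypotheses (hC : unital_cone C u) (hK : unital_cone K e).
Hypothesis hPsi : gauge_reversal C u K e Psi.
Hypothesis dinf : directed_infima C u.

Lemma atom_in p : atom C u p -> C p.
Proof. by move=> [[]]. Qed.

Lemma atom_le p mu : atom C u p -> C (mu *: u - p) <-> 1 <= mu.
Proof.
by move=> [_ p1]; rewrite -p1; apply: iff_sym; apply: (gauge_le hC) => //; exact: inner_unit.
Qed.

Lemma inner_atom p t : atom C u p -> -1 < t -> inner C u (u + t *: p).
Proof.
move=> ap t1; have iu := inner_unit hC; have Cp := atom_in ap.
have [t0|t0] := leP 0 t; first by apply: innerD => //; exact: (ucZ hC).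
have t1' : 0 < 1 + t by lra.
have h : C (u - p) by have := (atom_le 1 ap).2 (lexx _); rewrite scale1r.
have tN : 0 <= - t by lra.
rewrite (_ : u + t *: p = (1 + t) *: u + (- t) *: (u - p)); last by module_eq R.
by apply: innerD; [exact: hC|exact: innerZ|exact: (ucZ hC)].
Qed.

Lemma represents_unit phi p : atom C u p -> represents C u Psi phi p ->
  phi (Psi u) = 1.
Proof.
move=> ap hp; have iu := inner_unit hC; apply/eqP; rewrite eq_le.
apply/andP; split; first by apply/(hp _ iu)/(atom_le _ ap).
by apply/(atom_le _ ap)/(hp _ iu).
Qed.

Lemma represents_atom_line phi q t : atom C u q -> represents C u Psi phi q ->
  -1 < t -> phi (Psi (u + t *: q)) = (1 + t)^-1.
Proof.
move=> aq hq t1; have iq := inner_atom aq t1; apply/eqP; rewrite eq_le.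
have t1' : 0 < 1 + t by lra.
have tV : 0 < (1 + t)^-1 by rewrite invr_gt0.
apply/andP; split.
  apply/(hq _ iq).
  have h : C (u - q) by have := (atom_le 1 aq).2 (lexx _); rewrite scale1r.
  by apply: uc_eq (ucZ hC (ltW tV) h) _; module_eq R; field; lra.
have hmu := (hq _ iq (phi (Psi (u + t *: q)))).2 (lexx _).
set mu := phi _ in hmu *.
have [q0 Cq _] := aq.1.
have mu0 := inner_gt0 hC iq Cq q0 hmu.
rewrite leNgt; apply/negP => lt.
have lt' : mu * (1 + t) < 1.
  by have := lt; rewrite -(ltr_pM2r t1') mulVf // gt_eqF.
have k0 : 0 < 1 - mu * t by lra.
have kV : 0 <= (1 - mu * t)^-1 by rewrite invr_ge0 ltW.
have : C ((mu / (1 - mu * t)) *: u - q).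
  by apply: uc_eq (ucZ hC kV hmu) _; module_eq R; field; lra.
by move/(atom_le _ aq); rewrite ler_pdivlMr // mul1r; lra.
Qed.

(** Along the line [u + t q] the image of [Psi] moves on a segment, so that all
    the functions [phi (Psi (u + t q))] are affine functions of one of them; the
    functional that represents [q] itself gives [(1 + t)^-1]. *)
Lemma represents_line phi psi q s r t : atom C u q -> positive_functional K phi ->
  positive_functional K psi -> represents C u Psi psi q ->
  -1 < s -> s <= r -> r <= t ->
  (phi (Psi (u + s *: q)) - phi (Psi (u + r *: q))) * ((1 + s)^-1 - (1 + t)^-1) =
  ((1 + s)^-1 - (1 + r)^-1) * (phi (Psi (u + s *: q)) - phi (Psi (u + t *: q))).
Proof.
move=> aq [linphi _] [linpsi _] hq s1 sr rt.
have r1 : -1 < r by lra.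
have t1 : -1 < t by lra.
have st : 0 <= t - s by lra.
have tE : u + s *: q + (t - s) *: q = u + t *: q by module_eq R.
have [is_ ir it] : [/\ inner C u (u + s *: q), inner C u (u + r *: q) &
  inner C u (u + t *: q)] by split; exact: inner_atom.
have Cq := atom_in aq.
have [||l lE] := image_chain hC hK hPsi (s := Psi (u + s *: q) - Psi (u + r *: q))
    is_ st aq.1.
- apply/(gr_le1 hPsi) => //.
  have rs : 0 <= r - s by lra.
  by apply: uc_eq (ucZ hC rs Cq) _; module_eq R.
- rewrite tE (_ : _ - _ - _ = Psi (u + r *: q) - Psi (u + t *: q)); last by module_eq R.
  apply/(gr_le1 hPsi) => //.
  have rs : 0 <= t - r by lra.
  by apply: uc_eq (ucZ hC rs Cq) _; module_eq R.
rewrite tE in lE.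
have ephi := congr1 phi lE; have epsi := congr1 psi lE.
move: ephi epsi; rewrite (scalfZ _ _ linphi) (scalfZ _ _ linpsi).
rewrite !(scalfB _ _ linphi) !(scalfB _ _ linpsi) !(represents_atom_line aq hq) // => -> ->.
by ring.
Qed.

(** Evaluating [xi] on [p <= M(p/v) v] at [v = u + t q] gives
    [1 <= M(p/v) (1 + t * xi q)], with equality at [t = 0] inside the domain of
    [t]; so the derivative of the gauge at 0 is [- xi q]. *)
Lemma represents_state_line phi p q xi t : atom C u p -> atom C u q ->
  positive_functional K phi -> represents C u Psi phi p ->
  states C u xi -> xi p = 1 -> -1 < t ->
  phi (Psi (u + t *: q)) = 1 - t / (1 + t) * xi q.
Proof.
move=> ap aq pphi hp [lin pos xiu] xip t1.
have [psi ppsi hq] := extreme_vector_represented hC hK hPsi dinf aq.1.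
apply: (@affine_in_inverse _ (fun t => phi (Psi (u + t *: q)))) => //.
- by rewrite scale0r addr0; exact: represents_unit hp.
- by move=> s r t'; exact: represents_line hq.
move=> r r1; have ir := inner_atom aq r1.
have := pos _ ((hp _ ir _).2 (lexx _)).
by rewrite (scalfB _ _ lin) (scalfZ _ _ lin) (scalfD _ _ lin) (scalfZ _ _ lin) xip xiu; lra.
Qed.

Lemma atoms_le_unit p q xi a s : atom C u p -> atom C u q ->
  states C u xi -> xi p = 1 -> 0 < a -> 0 < s < 1 ->
  C (u - (a *: p + s *: q)) <-> 1 + s / (1 - s) * xi q <= a^-1.
Proof.
move=> ap aq sxi xip a0 /andP[s0 s1].
have [phi pphi hp] := extreme_vector_represented hC hK hPsi dinf ap.1.
have s1' : -1 < - s by lra.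
have aV : 0 < a^-1 by rewrite invr_gt0.
have := hp _ (inner_atom aq s1') a^-1.
rewrite (represents_state_line ap aq pphi hp sxi xip s1').
rewrite (_ : 1 - - s / (1 - s) * xi q = 1 + s / (1 - s) * xi q); last by ring.
move=> h; split=> [H|/h H].
  apply/h.
  by apply: uc_eq (ucZ hC (ltW aV) H) _; module_eq R; field; lra.
by apply: uc_eq (ucZ hC (ltW a0) H) _; module_eq R; field; lra.
Qed.

(** Both sides are the infimum of the [k > 0] such that [p / 2 + q / (1 + k) <= u]. *)
Lemma state_atom_sym p q xi zeta : atom C u p -> atom C u q ->
  states C u xi -> xi p = 1 -> states C u zeta -> zeta q = 1 -> xi q = zeta p.
Proof.
move=> ap aq sxi xip szeta zetaq.
have key k : 0 < k -> xi q <= k <-> zeta p <= k.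
  move=> k0; have k1 : 0 < 1 + k by lra.
  have kV : 0 < (1 + k)^-1 by rewrite invr_gt0.
  have kV1 : (1 + k)^-1 < 1 by rewrite invf_lt1 //; lra.
  have h1 := atoms_le_unit (a := 2^-1) (s := (1 + k)^-1) ap aq sxi xip
    ltac:(lra) ltac:(lra).
  have h2 := atoms_le_unit (a := (1 + k)^-1) (s := 2^-1) aq ap szeta zetaq
    ltac:(lra) ltac:(lra).
  rewrite [_ *: q + _]addrC in h2; move: h1 h2; rewrite !invrK => h1 h2.
  have -> : (xi q <= k) = (1 + (1 + k)^-1 / (1 - (1 + k)^-1) * xi q <= 2).
    rewrite (_ : (1 + k)^-1 / (1 - (1 + k)^-1) = k^-1); last by field; lra.
    rewrite -(ler_pM2l (x := k^-1)) ?invr_gt0 // mulVf ?gt_eqF //.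
    by apply/idP/idP; lra.
  have -> : (zeta p <= k) = (1 + 2^-1 / (1 - 2^-1) * zeta p <= 1 + k).
    by rewrite (_ : 2^-1 / (1 - 2^-1) = 1) ?mul1r ?lerD2l //; field.
  exact: iff_trans (iff_sym h1) h2.
have xi0 : 0 <= xi q by have [_ pos _] := sxi; exact: pos _ (atom_in aq).
have zeta0 : 0 <= zeta p by have [_ pos _] := szeta; exact: pos _ (atom_in ap).
apply/eqP; rewrite eq_le; apply/andP; split; apply/ler_addgt0Pl => d d0.
  by apply/key; rewrite ?ltr_wpDr // lerDr ltW.
by apply/key; rewrite ?ltr_wpDr // lerDr ltW.
Qed.

(** The linear minorants of [x |-> M(x/u)] are the states, and [M(p/u) = 1]. *)
Lemma exists_pure_state p : atom C u p ->
  exists xi, pure_state C u xi /\ xi p = 1.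
Proof.
move=> ap; have iu := inner_unit hC.
pose E (y : V) (mu : R) := C (mu *: u - y).
have epi : epigraph E.
  split.
  - by move=> y; have [l l0 hl] := inner_bound hC y iu; exists l.
  - move=> y; have [l l0 hl] := uc_bound hC y; exists (- l) => mu h.
    have : C (- ((- mu - l) *: u)) by apply: uc_eq (ucD hC h hl) _; module_eq R.
    by move/(uc_unitN hC); lra.
  - move=> a b mu nu h h'; exists (mu + nu) => //.
    by apply: uc_eq (ucD hC h h') _; module_eq R.
  - move=> l a mu l0 h; exists (l * mu) => //.
    by apply: uc_eq (ucZ hC (ltW l0) h) _; module_eq R.
have minP xi : minorant (epi_inf E) xi <-> states C u xi.
  split=> [[lin le]|sxi].
    have le' y mu : C (mu *: u - y) -> xi y <= mu.
      by move=> h; apply: le_trans (le y) _; exact: epi_inf_le.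
    split=> // [v Cv|].
      rewrite -oppr_le0 -(scalfN _ lin); apply: le'.
      by apply: uc_eq Cv _; module_eq R.
    apply/eqP; rewrite eq_le; apply/andP; split.
      by apply: le'; rewrite scale1r subrr; exact: uc0 hC.
    rewrite -lerN2 -(scalfN _ lin); apply: le'.
    by apply: uc_eq (uc0 hC) _; module_eq R.
  split=> [|y]; first by have [] := sxi.
  by apply: le_epi_inf => // mu; exact: states_bound.
have [xi [mxi ext] xip] := exists_extreme_minorant p (epi_inf_sublinear epi).
exists xi; split; first split; first exact/minP.
  by move=> t xi1 xi2 t01 /minP m1 /minP m2; exact: (ext t).
rewrite xip; apply/eqP; rewrite eq_le; apply/andP; split.
  by apply: epi_inf_le => //; apply/(atom_le _ ap).
by apply: le_epi_inf => // mu /(atom_le _ ap).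
Qed.

Lemma psi_atomP p : atom C u p ->
  states C u (psi_atom C u p) /\ psi_atom C u p p = 1.
Proof.
move=> /exists_pure_state h.
by have [[]] := @xgetPex _ (fun=> 0) [set psi | pure_state C u psi /\ psi p = 1] h.
Qed.

Lemma psi_atom_sym p q : atom C u p -> atom C u q ->
  psi_atom C u p q = psi_atom C u q p.
Proof.
move=> ap aq; have [sp pp] := psi_atomP ap; have [sq qq] := psi_atomP aq.
exact: state_atom_sym.
Qed.

Hypothesis hspan : spanned_by_atoms C u.

(** Expanding [y] instead of [x] shows that the value of the form does not depend
    on the decomposition of [x] into atoms. *)
Lemma atom_formE x n (mu : 'I_n -> R) (q : 'I_n -> V) : (forall k, atom C u (q k)) ->
  atom_form C u x (\sum_(k < n) mu k *: q k) =
  \sum_(k < n) mu k * psi_atom C u (q k) x.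
Proof.
move=> aq; set y := \sum_(k < n) _.
have val m (l : 'I_m -> R) (p : 'I_m -> V) : (forall k, atom C u (p k)) ->
    x = \sum_(k < m) l k *: p k ->
    \sum_(k < m) l k * psi_atom C u (p k) y = \sum_(k < n) mu k * psi_atom C u (q k) x.
  move=> ap ->.
  under eq_bigr => k _.
    have [[lin _ _] _] := psi_atomP (ap k).
    rewrite /y (scalf_sum _ _ lin) mulr_sumr; over.
  rewrite exchange_big /=; apply: eq_bigr => k _.
  have [[lin _ _] _] := psi_atomP (aq k).
  rewrite (scalf_sum _ _ lin) mulr_sumr; apply: eq_bigr => j _.
  by rewrite (psi_atom_sym (ap j) (aq k)) mulrCA.
rewrite /atom_form; set S := [set z | _].
have [m [l [p [ap xE]]]] := hspan x.
have [m' [l' [p' [ap' xE' ->]]]] : S (xget 0 S).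
  by apply: xgetPex; exists (\sum_(k < m) l k * psi_atom C u (p k) y), m, l, p.
exact: val.
Qed.

Lemma atom_form_atom x p : atom C u p -> atom_form C u x p = psi_atom C u p x.
Proof.
move=> ap; have := @atom_formE x 1 (fun=> 1) (fun=> p) (fun=> ap).
by rewrite !big_ord1 scale1r mul1r.
Qed.

Lemma atom_form_scalar y : scalar (fun x => atom_form C u x y).
Proof.
have [n [mu [q [aq ->]]]] := hspan y; move=> l a b; rewrite !atom_formE //.
rewrite mulr_sumr -big_split; apply: eq_bigr => k _ /=.
by have [[lin _ _] _] := psi_atomP (aq k); rewrite lin; ring.
Qed.

Lemma extreme_atom r : extreme_vector C r ->
  exists2 l : R, 0 < l & exists2 p, atom C u p & r = l *: p.
Proof.
move=> [r0 Cr ext]; have iu := inner_unit hC.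
have h mu := @gauge_le _ _ _ _ hC r u mu iu.
have g0 : 0 < gauge C r u by apply: (inner_gt0 hC iu Cr r0); exact/h.
have gV : 0 < (gauge C r u)^-1 by rewrite invr_gt0.
exists (gauge C r u) => //; exists ((gauge C r u)^-1 *: r); last first.
  by rewrite scalerA mulfV ?scale1r // gt_eqF.
split; first split.
- by rewrite scaler_eq0 negb_or r0 gt_eqF.
- by apply: (ucZ hC) => //; exact: ltW.
- move=> v v0; rewrite /cone_le => vr.
  have [||l l0 vE] := ext (gauge C r u *: v).
  + by move: v0; rewrite /cone_le !subr0 => Cv; apply: (ucZ hC) => //; exact: ltW.
  + by rewrite /cone_le; apply: uc_eq (ucZ hC (ltW g0) vr) _; module_eq R; field; lra.
  exists l => //; rewrite scalerA mulrC -scalerA -vE scalerA mulVf ?scale1r //.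
  by rewrite gt_eqF.
have h' mu : gauge C ((gauge C r u)^-1 *: r) u <= mu <-> 1 <= mu.
  apply: iff_trans (gauge_le hC _ mu iu) _.
  have -> : (1 <= mu) = (gauge C r u <= gauge C r u * mu) by rewrite ler_pMr.
  apply: iff_trans _ (iff_sym (h _)); split=> {}h.
    by apply: uc_eq (ucZ hC (ltW g0) h) _; module_eq R; field; lra.
  by apply: uc_eq (ucZ hC (ltW gV) h) _; module_eq R; field; lra.
by apply/eqP; rewrite eq_le; apply/andP; split; [apply/h'|apply/h'].
Qed.

(** Test [x] on the point [v = u - t x] with [t > 0] small: since
    [psi_p v <= 1], the gauge of [p] relative to [v] is at least 1, its value at
    [u].  As gauges of extreme vectors determine the order, [v <= u]. *)
Lemma atom_form_ge0_in x : (forall y, C y -> 0 <= atom_form C u x y) -> C x.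
Proof.
move=> h; have iu := inner_unit hC.
have [l l0 hl] := inner_bound hC x iu.
have l1 : 0 < l + 1 by lra.
have t0 : 0 < (l + 1)^-1 by rewrite invr_gt0.
set t := (l + 1)^-1 in t0.
have iv : inner C u (u - t *: x).
  exists t => //; apply: uc_eq (ucZ hC (ltW t0) hl) _.
  by rewrite /t; module_eq R; field; lra.
have vu : C (u - (u - t *: x)).
  apply: (extreme_gauge_order hC hK hPsi dinf) => // r mu er hr.
  have [k k0 [p ap rE]] := extreme_atom er.
  have [[lin pos psiu] psip] := psi_atomP ap.
  have psix : 0 <= psi_atom C u p x by rewrite -atom_form_atom //; exact/h/atom_in.
  have mu0 : 0 < mu by have [r0 Cr _] := er; exact: (inner_gt0 hC iv Cr r0 hr).
  have := pos _ hr; rewrite rE (scalfB _ _ lin) (scalfZ _ _ lin) (scalfB _ _ lin).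
  rewrite psiu !(scalfZ _ _ lin) psip => le.
  have kmu : k <= mu by have := mulr_ge0 (ltW t0) psix; nra.
  have kV : 0 <= mu / k - 1 by rewrite subr_ge0 ler_pdivlMr // mul1r.
  have hp : C (k *: (u - p)).
    by apply: (ucZ hC (ltW k0)); have := (atom_le 1 ap).2 (lexx _); rewrite scale1r.
  have mk : 0 <= mu - k by lra.
  by apply: uc_eq (ucD hC hp (ucZ hC mk (uc_unit hC))) _; module_eq R.
have tV : 0 <= t^-1 by rewrite invr_ge0 ltW.
by apply: uc_eq (ucZ hC tV vu) _; module_eq R; field; lra.
Qed.

(** By Zorn's lemma there is a minimal [z] in [C] with [B(z, y) <= B(x, y)], because
    decreasing nets of [C] converge; a nonzero [z] could be decreased further by
    an extreme vector below it, so [z = 0]. *)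
Lemma atom_form_ge0 x y : C x -> C y -> 0 <= atom_form C u x y.
Proof.
move=> Cx Cy; set B := fun z => atom_form C u z y.
have linB : scalar B := atom_form_scalar y.
have Bext r : extreme_vector C r -> 0 <= B r.
  move=> /extreme_atom [l l0 [p ap ->]]; rewrite (scalfZ _ _ linB).
  have [n [mu [q [aq yE]]]] := hspan y.
  apply: mulr_ge0; first exact: ltW.
  have [[lin pos _] _] := psi_atomP ap.
  suff -> : B p = psi_atom C u p y by exact: pos.
  rewrite /B yE atom_formE // (scalf_sum _ _ lin); apply: eq_bigr => k _.
  by rewrite psi_atom_sym.
(* [B] is a combination of states, hence continuous for the order unit norm. *)
have [M M0 BM] : exists2 M, 0 <= M &
    forall z d, C z -> C (d *: u - z) -> - (d * M) <= B z.
  have [n [mu [q [aq yE]]]] := hspan y.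
  exists (\sum_(k < n) `|mu k|); first by apply: sumr_ge0.
  move=> z d Cz hd; rewrite /B yE atom_formE // lerNl -sumrN mulr_sumr.
  apply: ler_sum => k _; have [sk _] := psi_atomP (aq k); have [_ pos _] := sk.
  have h1 := states_bound sk hd; have h2 := pos _ Cz.
  rewrite -mulNr; apply: le_trans (ler_norm _) _.
  by rewrite normrM normrN (ger0_norm h2) mulrC ler_wpM2r.
pose T := {z : V | C z /\ B z <= B x}.
pose mkT z (Cz : C z) (Bz : B z <= B x) : T :=
  exist (fun z => C z /\ B z <= B x) z (conj Cz Bz).
pose below (z1 z2 : T) := `[< C (sval z1 - sval z2) >].
have [| | | |[z [Cz Bz]] zmin] := @Zorn T below.
- by move=> z; apply/asboolP; rewrite subrr; exact: uc0 hC.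
- move=> r s t /asboolP h1 /asboolP h2; apply/asboolP.
  exact: (uc_trans hC) h2 h1.
- move=> [s hs] [t ht] /asboolP /= h1 /asboolP /= h2; apply: eq_exist => /=.
  exact: (uc_le_anti hC).
- move=> A tot; have [[a Aa]|Ane] := pselect (A !=set0); last first.
    exists (mkT x Cx (lexx _)) => s As.
    by exfalso; apply: Ane; exists s.
  pose A' := [set sval z | z in A].
  have A'0 : A' !=set0 by exists (sval a); exists a.
  have A'C : A' `<=` C by move=> _ [[z [Cz ?]] _ <-].
  have A'dir : down_directed C A'.
    move=> _ _ [z1 Az1 <-] [z2 Az2 <-].
    have C0 := uc0 hC.
    have [/asboolP h|/asboolP h] := tot _ _ Az1 Az2.
      by exists (sval z2); [exists z2|rewrite subrr].
    by exists (sval z1); [exists z1|rewrite subrr].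
  have [r Cr [rA rinf]] := dinf A'0 A'C A'dir.
  have Br : B r <= B x.
    apply/ler_addgt0Pl => d d0.
    have k0 : 0 < d / (M + 1) by apply: divr_gt0 => //; lra.
    have [_ [w Aw <-] hw] := rinf _ k0.
    have h1 : C (sval w - r) by apply: rA; exists w.
    have h2 : C ((d / (M + 1)) *: u - (sval w - r)).
      by apply: uc_eq hw _; module_eq R.
    have := BM _ _ h1 h2; rewrite (scalfB _ _ linB).
    have : d / (M + 1) * M <= d by rewrite mulrAC ler_pdivrMr ?ler_pM2l //; lra.
    by have := (svalP w).2; lra.
  exists (mkT r Cr Br) => s As; apply/asboolP => /=; apply: rA; by exists s.
have [z0|z0] := eqVneq z 0; first by rewrite -(scalf0 linB) -z0.
have [r er zr] := extreme_vector_below hC hK hPsi dinf Cz z0.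
have [r0 Cr _] := er.
have Bzr : B (z - r) <= B x by have := Bext _ er; rewrite (scalfB _ _ linB); lra.
have bel : below (mkT z Cz Bz) (mkT _ zr Bzr).
  by apply/asboolP; apply: uc_eq Cr _; rewrite /=; module_eq R.
have zE : z - r = z := congr1 (fun s : T => sval s) (zmin _ bel).
by move/eqP: r0; case; rewrite -(subKr z r) zE subrr.
Qed.

End atoms.

(** * Self-duality *)

Lemma order_unit_space0 (R : realType) (V : normedModType R) (C : set V) :
  order_unit_space C 0 -> forall v : V, v = 0.
Proof.
move=> hC v; have [l [_ +]] := order_unitP hC v.
rewrite /cone_le scaler0 oppr0 subr0 sub0r => Cv CNv.
exact/(cone_pointed hC).
Qed.

Lemma gauge_reversing_reversal (R : realType) (V W : normedModType R) (C : set V)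
    (u : V) (K : set W) (e : W) (Psi : V -> W) :
  order_unit_space C u -> order_unit_space K e -> u != 0 -> e != 0 ->
  gauge_reversing C K Psi -> gauge_reversal C u K e Psi.
Proof.
move=> hV hW u0 e0 [[homo_Psi _ surj_Psi] gaugeE].
have hC := order_unit_space_unital hV u0; have hK := order_unit_space_unital hW e0.
have iC := interior_inner hV u0; have iK := interior_inner hW e0.
have inPsi v : inner C u v -> inner K e (Psi v) by rewrite -iC -iK => /homo_Psi.
split=> //.
  by move=> y; rewrite -iK => /surj_Psi [v iv vy]; exists v; rewrite -?iC.
move=> v w mu iv iw; apply: iff_trans (iff_sym (gauge_le hC v mu iw)) _.
by rewrite gaugeE ?iC //; apply: (gauge_le hK); exact: inPsi.
Qed.

(** A one-point interior of [K] would make the interior of [C], which contains [u]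
    and [2 u], a point. *)
Lemma gauge_reversing_neq0 (R : realType) (V W : normedModType R) (C : set V)
    (u : V) (K : set W) (e : W) (Psi : V -> W) :
  order_unit_space C u -> order_unit_space K e -> u != 0 ->
  gauge_reversing C K Psi -> e != 0.
Proof.
move=> hV hW u0 [[_ injPsi _] _]; apply/eqP => e0.
have hC := order_unit_space_unital hV u0; have iC := interior_inner hV u0.
have W0 : forall w : W, w = 0 by apply: (@order_unit_space0 _ _ K); rewrite -e0.
have iu := inner_unit hC; have i2u := innerZ hC (ltr0n R 2) iu.
have : 2 *: u = u by apply: injPsi; rewrite ?inE ?iC // [LHS]W0 [RHS]W0.
move=> /(congr1 (fun v => v - u)); rewrite subrr => /eqP.
rewrite (_ : 2 *: u - u = u); last by module_eq R.
by rewrite (negbTE u0).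
Qed.

(** If [u = 0] then [V] is a point, there are no atoms, and the only decompositions
    are empty sums. *)
Lemma self_dual0 (R : realType) (V : normedModType R) (C : set V) :
  order_unit_space C 0 -> spanned_by_atoms C 0 -> self_dual C (atom_form C 0).
Proof.
move=> hV hspan; have V0 := order_unit_space0 hV.
have C0 : C 0 by exact: order_unit_in hV.
apply/seteqP; split=> x /= _; last by rewrite (V0 x).
move=> y _; rewrite /atom_form; set S := [set z | _].
have [m [l [p [ap xE]]]] := hspan x.
have [n [l' [p' [ap' _ ->]]]] : S (xget 0 S).
  by apply: xgetPex; exists (\sum_(k < m) l k * psi_atom C 0 (p k) y), m, l, p.
rewrite big1 // => k _; have [[pk0 _ _] _] := ap' k.
by move: pk0; rewrite (V0 (p' k)) eqxx.
Qed.

Theorem theorem8p10 (R : realType) (V W : completeNormedModType R)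
    (C : set V) (u : V) (K : set W) (e : W) (Psi : V -> W)
    (hV : order_unit_space C u) (hW : order_unit_space K e)
    (hspan : spanned_by_atoms C u)
    (hsc : cone_functions C u = Csc C u)
    (hPsi : gauge_reversing C K Psi) :
  self_dual C (atom_form C u).
Proof.
have [u0|u0] := eqVneq u 0.
  by move: hV hspan; rewrite u0 => hV0 hspan0; exact: self_dual0.
have e0 := gauge_reversing_neq0 hV hW u0 hPsi.
have hC := order_unit_space_unital hV u0; have hK := order_unit_space_unital hW e0.
have rev := gauge_reversing_reversal hV hW u0 e0 hPsi.
have dinf := csc_directed_infima hC hsc.
apply/seteqP; split=> x /= h; last exact: (atom_form_ge0_in hC hK rev dinf hspan).
by move=> y Cy; exact: (atom_form_ge0 hC hK rev dinf hspan).
Qed.
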